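(* There exists a positive constant $C_1$ such that $$\Vert f \Vert_{L^{3/2,\infty}(\mathbb{R}^3,\mathbb{C}^2)} \le C_1 \int_{\mathbb{R}^3} |(\boldsymbol{\sigma}\cdot\mathbf{p}) f(\mathbf{x})|\, d\mathbf{x}$$ for all $f \in C_0^{\infty}(\mathbb{R}^3,\mathbb{C}^2)$.
   Context: $C_0^\infty(\mathbb{R}^3,\mathbb{C}^2)$ is the space of $\mathbb{C}^2$-valued functions on $\mathbb{R}^3$ whose components are smooth with compact support. The Pauli matrices are $\sigma_1=\begin{pmatrix}0&1\\1&0\end{pmatrix}$, $\sigma_2=\begin{pmatrix}0&-i\\i&0\end{pmatrix}$, $\sigma_3=\begin{pmatrix}1&0\\0&-1\end{pmatrix}$, and $\boldsymbol{\sigma}\cdot\mathbf{p} = -i\sum_{j=1}^3 \sigma_j \frac{\partial}{\partial x_j}$. For $\mathbf{a}=(a_1,a_2)\in\mathbb{C}^2$, $|\mathbf{a}| = |a_1|+|a_2|$. For $q>0$, the weak-$L^q$ quasi-norm is $$\Vert f\Vert_{L^{q,\infty}} = \Vert f\Vert_{q,\infty} := \Big(\sup_{t>0}\, t^q \mu(\{\mathbf{x}\in\mathbb{R}^3 : |f(\mathbf{x})|>t\})\Big)^{1/q},$$ where $\mu$ is Lebesgue measure. *)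

(* Defs.v *)
From mathcomp Require Import all_boot all_order all_algebra.
From mathcomp Require Import all_classical all_reals all_analysis.
From mathcomp Require Import complex.

Set Implicit Arguments.
Unset Strict Implicit.
Unset Printing Implicit Defensive.

Import Order.TTheory GRing.Theory Num.Theory.
Import numFieldNormedType.Exports.

Local Open Scope classical_set_scope.
Local Open Scope ring_scope.

Section Definitions.
Context {R : realType}.

(* R^3 is the product R * R * R, which carries both a normed module structure
   over R (with the max norm, hence the Euclidean topology) and the product
   sigma-algebra, i.e. the Borel one. *)
Local Notation R3 := (R * R * R)%type.
Local Notation C2 := 'cV[R[i]]_2.

Definition mu3 :=
  ((@lebesgue_measure R \x @lebesgue_measure R) \x @lebesgue_measure R)%E.

Definition basis3 (j : 'I_3) : R3 := ((j == 0)%:R, (j == 1)%:R, (j == 2)%:R).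

Definition partial (j : 'I_3) (u : R3 -> R) : R3 -> R :=
  fun x => 'D_(basis3 j) u x.

Definition iter_partial (s : seq 'I_3) (u : R3 -> R) : R3 -> R :=
  foldr partial u s.

(* 'D_v is a total operator, so differentiability has to be required along
   with the continuity of the partial derivatives of every order. *)
Definition smooth (u : R3 -> R) : Prop :=
  forall s : seq 'I_3,
    continuous (iter_partial s u) /\
    forall (j : 'I_3) (x : R3), derivable (iter_partial s u) x (basis3 j).

Definition csmooth (g : R3 -> R[i]) : Prop :=
  smooth (fun x => complex.Re (g x)) /\ smooth (fun x => complex.Im (g x)).

Definition compactly_supported (g : R3 -> R[i]) : Prop :=
  compact (closure [set x | g x != 0]).

Definition C0infty (f : R3 -> C2) : Prop :=
  forall k : 'I_2, csmooth (fun x => f x k 0) /\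
                   compactly_supported (fun x => f x k 0).

Definition cpartial (j : 'I_3) (g : R3 -> R[i]) : R3 -> R[i] :=
  fun x => (partial j (fun y => complex.Re (g y)) x
            +i* partial j (fun y => complex.Im (g y)) x)%C.

Definition mx2 (a b c d : R[i]) : 'M[R[i]]_2 :=
  \matrix_(k, l) if k == 0 then (if l == 0 then a else b)
                 else (if l == 0 then c else d).

Definition pauli (j : 'I_3) : 'M[R[i]]_2 :=
  tnth [tuple mx2 0 1 1 0; mx2 0 (- 'i%C) 'i%C 0; mx2 1 0 0 (- 1)] j.

Definition sigma_p (f : R3 -> C2) : R3 -> C2 :=
  fun x => - 'i%C *: \sum_(j < 3) (pauli j *m
             \col_(k < 2) cpartial j (fun y => f y k 0) x).

(* |a| = |a_1| + |a_2|; Normc.normc is the R-valued modulus on R[i]. *)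
Definition normC2 (a : C2) : R := \sum_(k < 2) Normc.normc (a k 0).

Definition weakL_norm (q : R) (f : R3 -> C2) : \bar R :=
  (ereal_sup [set (t `^ q)%:E * mu3 [set x | (t < normC2 (f x))%R]
             | t in [set t : R | (0 < t)%R]] `^ q^-1)%E.

End Definitions.

(* Main.v *)
Require Import Defs.
From HB Require Import structures.
From mathcomp Require Import all_boot all_order all_algebra.
From mathcomp Require Import all_classical all_reals all_analysis.
From mathcomp Require Import measurable_realfun complex ring lra.

(* Regularise the Dirac kernel: K(z) = z / (|z|^2 + e^2)^(3/2) is a gradient, so
   it is curl-free, and its divergence m(z) = 3 e^2 / (|z|^2 + e^2)^(5/2) is a
   multiple of an approximate identity. Hence (sigma.K)(sigma.grad f) + m f is a
   sum of partial derivatives of compactly supported functions and integrates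
   to 0. As |K(z)| <= |z|^-2 for every e, letting e -> 0 gives, for some constant C,
   |f(x)| <= C \int |x - y|^-2 |sigma.p f(y)| dy, without computing m's mass:
   a lower bound on the cube of half-side e suffices.
   For E = {|f| > t}, integrate this over E. Splitting |x - y|^-2 into dyadic
   shells gives \int_E |x - y|^-2 dx <= 65 mu(E)^(1/3), so by Tonelli
   t mu(E) <= C mu(E)^(1/3) \int |sigma.p f|, which is the weak-type bound. *)

(** For an integrable g the Riesz potential with kernel |x - y|^-2 lies in general only in weak
    L^(3/2), so the estimate is made one superlevel set at a time: what is left after cancellation
    is t mu(E)^(2/3), whose power 3/2 is the expression in the weak norm. The Pauli relations give
    (sigma.K)(sigma.grad f) = K.grad f + i sigma.(K x grad f). The first term plus (div K) f is the
    divergence of K f; since curl K = 0, the cross product is minus the curl of K f, again a sum of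
    partial derivatives. Only the real part of the first component is worked out, and symmetries of
    the Dirac operator supply the other three real components. Regularisation keeps each product of
    kernel and test function C^1 across the singularity, so integration by parts is the fundamental
    theorem of calculus on lines. No limit is taken under an integral: the majorant |x - y|^-2 is
    independent of e, and e is fixed once for each tolerance. *)

Set Implicit Arguments.
Unset Strict Implicit.
Unset Printing Implicit Defensive.
Import Order.TTheory GRing.Theory Num.Theory.
Import numFieldNormedType.Exports.

Local Open Scope classical_set_scope.
Local Open Scope ring_scope.

(** * Cubes, measurability of open sets, and Fubini on R^3 *)

Section Cubes.
Variable R : realType.
Local Notation M1 := (measurableTypeR R).
Local Notation leb := (@lebesgue_measure R).
Local Notation M3 := (M1 * M1 * M1)%type.

(** Connects the topology with the product sigma-algebra: an open set is the union of the boxes of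
    rational centre and radius 1/(n+1) that it contains, and these are countably many. *)
Lemma open_measurable3 (U : set (R * R * R)) : open U -> measurable (U : set M3).
Proof.
move=> oU.
pose box (q : rat * rat * rat) (n : nat) : set (R * R * R) :=
  (ball (ratr q.1.1 : R) n.+1%:R^-1 `*` ball (ratr q.1.2 : R) n.+1%:R^-1)
  `*` ball (ratr q.2 : R) n.+1%:R^-1.
pose F (i : rat * rat * rat * nat) : set M3 := if `[< box i.1 i.2 `<=` U >] then box i.1 i.2 else set0.
have -> : U = \bigcup_i F i.
  apply/seteqP; split => [[[x y] z] Uxyz|x [i _]]; last first.
    by rewrite /F; case: asboolP => // h /h.
  have /nbhs_ballP[e /= e0 he] : nbhs ((x, y), z) U by exact: open_nbhs_nbhs.
  (* With 1/(n+1) < e/2, two points of one such box differ by less than e in each coordinate, so a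
     box that contains the given point stays inside U. *)
  have /ltr_add_invr [n] : 0 < e / 2 by rewrite divr_gt0.
  rewrite add0r => ne.
  have hq (t : R) : exists q : rat, ball (ratr q : R) n.+1%:R^-1 t.
    have /rat_in_itvoo[q] : t < t + n.+1%:R^-1 by rewrite ltrDl invr_gt0.
    rewrite in_itv/= => /andP[q1 q2]; exists q.
    by rewrite /ball/= ger0_norm ?subr_ge0 ?(ltW q1)// ltrBlDl.
  have [p hp] := hq x; have [q hq'] := hq y; have [r hr] := hq z.
  exists (p, q, r, n) => //; rewrite /F /=.
  have hb (s : rat) (t u : R) : ball (ratr s : R) n.+1%:R^-1 t -> ball (ratr s : R) n.+1%:R^-1 u ->
     ball t e u.
    move=> /ball_sym h1 h2; apply: le_ball (ball_triangle h1 h2).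
    by rewrite [leRHS]splitr lerD// ltW.
  case: asboolP => [_|]; first by split => //; split.
  case=> -[[x' y'] z'] [[/= h1 h2] h3]; apply: he; split; [split; [exact: hb hp h1|exact: hb hq' h2]|exact: hb hr h3].
apply: countable_bigcupT_measurable => [|i]; first exact: countableP.
rewrite /F; case: asboolP => // _.
by apply: measurableX; [apply: measurableX|]; exact: measurable_ball.
Qed.

Lemma continuous_measurable3 (f : R * R * R -> R) :
  continuous f -> measurable_fun setT (f : M3 -> R).
Proof.
move=> cf; apply: (measurability _ (RGenOInfty.measurableE R)) => //.
move=> _ [_ [a ->] <-]; rewrite setTI; apply: open_measurable3.
by apply: open_comp => //; apply: rray_open.
Qed.

(** Balls of the max norm have an explicit product measure, so they replace Euclidean balls in every
    localisation; r is half the side. *)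
Definition cube (c : R * R * R) (r : R) : set M3 := ball c r.

Lemma measurable_cube c r : measurable (cube c r).
Proof. by case: c => -[c1 c2] c3; apply: measurableX; [apply: measurableX|]; exact: measurable_ball. Qed.

Lemma mu3_cube c r : 0 <= r -> mu3 (cube c r) = (8 * r ^+ 3)%:E.
Proof.
case: c => -[c1 c2] c3 r0.
have -> : cube (c1, c2, c3) r = (ball c1 r `*` ball c2 r) `*` ball c3 r by [].
rewrite /mu3 product_measure1E; [|by apply: measurableX; exact: measurable_ball|exact: measurable_ball].
rewrite [X in (X * _)%E = _]product_measure1E; [|exact: measurable_ball|exact: measurable_ball].
have E a : lebesgue_measure (ball a r) = (r *+ 2)%:E by exact: lebesgue_measure_ball.
by rewrite [X in (X * _ * _)%E]E [X in (_ * X * _)%E]E [X in (_ * X)%E]E -!EFinM; congr EFin; ring.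
Qed.

Lemma cubeE c r x : 
  cube c r x <-> [/\ `|x.1.1 - c.1.1| < r, `|x.1.2 - c.1.2| < r & `|x.2 - c.2| < r].
Proof.
case: c x => -[c1 c2] c3 [[x1 x2] x3] /=.
rewrite /cube /ball/= /prod_ball/= /ball/= /prod_ball/= /ball/= /ball_/=.
by rewrite ![`|c1 - _|]distrC ![`|c2 - _|]distrC ![`|c3 - _|]distrC; split=> [[[]]|[]].
Qed.

Lemma cube_normE r x : cube 0 r x <-> `|x| < r.
Proof. by rewrite /cube -ball_normE /= sub0r normrN. Qed.

Definition mu2 : set (M1 * M1) -> \bar R := (leb \x leb)%E.

Lemma mu2_square r : 0 <= r -> mu2 (ball 0 r `*` ball 0 r) = (4 * r ^+ 2)%:E.
Proof.
move=> r0; rewrite /mu2 product_measure1E; [|exact: measurable_ball|exact: measurable_ball].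
have E a : leb (ball a r) = (r *+ 2)%:E by exact: lebesgue_measure_ball.
by rewrite [X in (X * _)%E]E [X in (_ * X)%E]E -!EFinM; congr EFin; ring.
Qed.

Lemma sigma_finite_mu2 : sigma_finite setT mu2.
Proof.
exists (fun n => ball 0 n%:R `*` ball 0 n%:R) => [|n].
  apply/esym/seteqP; split => // -[x y] _; exists (Num.truncn (`|x| + `|y|)).+1 => //.
  have h := truncnS_gt (`|x| + `|y|); split; rewrite /ball /= sub0r normrN.
    by rewrite (le_lt_trans _ h)// lerDl.
  by rewrite (le_lt_trans _ h)// lerDr.
split; first by apply: measurableX; exact: measurable_ball.
by rewrite mu2_square// ltry.
Qed.

Lemma sigma_finite_mu3 : sigma_finite setT (@mu3 R).
Proof.
exists (fun n => cube 0 n%:R) => [|n].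
  apply/esym/seteqP; split => // x _; exists (Num.truncn `|x|).+1 => //.
  by apply/cube_normE; exact: truncnS_gt.
by split; [exact: measurable_cube|rewrite mu3_cube// ltry].
Qed.

(* For products of measures, canonical inference of a sigma-finite structure only
   finds the instance for subprobabilities, hence these named instances. *)
HB.instance Definition _ := Measure.on mu2.
HB.instance Definition _ := Measure_isSigmaFinite.Build _ _ _ mu2 sigma_finite_mu2.
HB.instance Definition _ := Measure.on (@mu3 R).
HB.instance Definition _ :=
  Measure_isSigmaFinite.Build _ _ _ (@mu3 R) sigma_finite_mu3.

Lemma mu3E : @mu3 R = (mu2 \x leb)%E. Proof. by []. Qed.

Lemma integral12_mu3 (f : M3 -> \bar R) : mu3.-integrable setT f ->
  (\int[mu3]_x f x = \int[mu2]_p \int[leb]_t f (p, t))%E.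
Proof.
move=> h; have h' : (mu2 \x leb)%E.-integrable setT f by exact: h.
by rewrite mu3E -(@integral12_prod_meas1 _ _ _ _ R mu2 leb f h').
Qed.

Lemma integral21_mu3 (f : M3 -> \bar R) : mu3.-integrable setT f ->
  (\int[mu3]_x f x = \int[leb]_t \int[mu2]_p f (p, t))%E.
Proof.
move=> h; have h' : (mu2 \x leb)%E.-integrable setT f by exact: h.
by rewrite mu3E -(@integral21_prod_meas1 _ _ _ _ R mu2 leb f h').
Qed.

Lemma integral12_mu2 (f : M1 * M1 -> \bar R) : mu2.-integrable setT f ->
  (\int[mu2]_x f x = \int[leb]_p \int[leb]_t f (p, t))%E.
Proof.
move=> h; have h' : (leb \x leb)%E.-integrable setT f by exact: h.
by rewrite /mu2 -(@integral12_prod_meas1 _ _ _ _ R leb leb f h').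
Qed.

Lemma integral21_mu2 (f : M1 * M1 -> \bar R) : mu2.-integrable setT f ->
  (\int[mu2]_x f x = \int[leb]_t \int[leb]_p f (p, t))%E.
Proof.
move=> h; have h' : (leb \x leb)%E.-integrable setT f by exact: h.
by rewrite /mu2 -(@integral21_prod_meas1 _ _ _ _ R leb leb f h').
Qed.

Lemma integrable_bounded_support d (T : measurableType d) (mu : {measure set T -> \bar R})
    (A : set T) (f : T -> R) (M : R) :
  measurable A -> (mu A < +oo)%E -> measurable_fun setT f ->
  (forall x, `|f x| <= M) -> (forall x, ~ A x -> f x = 0) ->
  mu.-integrable setT (EFin \o f).
Proof.
move=> mA Aoo mf fM f0.
have -> : (EFin \o f) = (EFin \o f) \_ A.
  apply/funext => x; rewrite patchE; case: ifPn => // /negP xL /=.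
  by rewrite f0// => h; apply: xL; rewrite inE.
apply/(integrable_mkcond _ mA).
apply: measurable_bounded_integrable => //; first exact: measurable_funTS.
exists M; split; first by rewrite num_real.
by move=> y yM x _; apply: le_trans (fM x) (ltW yM).
Qed.

Lemma integrable_cube (f : M3 -> R) (L M : R) : measurable_fun setT f ->
  (forall x, `|f x| <= M) -> (forall x, ~ cube 0 L x -> f x = 0) ->
  mu3.-integrable setT (EFin \o f).
Proof.
move=> mf fM f0.
have LL : L <= `|L| := ler_norm L.
apply: (@integrable_bounded_support _ _ _ (cube 0 `|L|) f M) => //.
- exact: measurable_cube.
- by rewrite [ltLHS]mu3_cube// ltry.
- move=> x nx; apply: f0 => /cubeE[h1 h2 h3]; apply: nx; apply/cubeE.
  by split; exact: lt_le_trans LL.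
Qed.
End Cubes.

(** * Integrals of compactly supported partial derivatives *)

Section DirectionalDerivative.
Variable R : realType.
Local Notation M1 := (measurableTypeR R).
Local Notation M3 := (M1 * M1 * M1)%type.
Local Notation leb := (@lebesgue_measure R).
Local Notation mu2 := (@mu2 R).

(** The two difference quotients are the same function of h; this brings one-variable calculus to
    directional derivatives. *)
Lemma is_derive_line (V : normedModType R) (f : V -> R) (x v : V) (t d : R) :
  is_derive t 1 (fun t => f (t *: v + x)) d <-> is_derive (t *: v + x) v f d.
Proof.
have E : (fun h => h^-1 *: (((fun t => f (t *: v + x)) \o shift t) (h *: 1) - f (t *: v + x))) =
         (fun h => h^-1 *: ((f \o shift (t *: v + x)) (h *: v) - f (t *: v + x))).
  by apply/funext => h /=; rewrite [h *: 1]mulr1 scalerDl addrA.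
split=> -[h1 h2]; split.
- by move: h1; rewrite /derivable E.
- by rewrite -h2 /derive E.
- by move: h1; rewrite /derivable -E.
- by rewrite -h2 /derive E.
Qed.

Lemma is_derive_dir_comp (V : normedModType R) (g : R -> R) (s : V -> R) (x v : V) (dg ds : R) :
  is_derive (s x) 1 g dg -> is_derive x v s ds -> is_derive x v (g \o s) (dg * ds).
Proof.
move=> hg hs; have x0 : x = 0 *: v + x by rewrite scale0r add0r.
rewrite x0; apply/is_derive_line.
apply: is_derive1_comp; first by rewrite -x0.
by apply/is_derive_line; rewrite -x0.
Qed.

Lemma integral_derive_eq0 (F D : R -> R) (L : R) :
  (forall t : R, is_derive t 1 F (D t)) -> continuous D ->
  (forall t, L <= `|t| -> F t = 0) -> (forall t, L <= `|t| -> D t = 0) ->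
  (\int[lebesgue_measure]_t (D t)%:E = 0)%E.
Proof.
move=> dF cD F0 D0.
(* L may be negative; with this bound the interval is nondegenerate and F vanishes at both ends. *)
pose L' := `|L| + 1.
have L'0 : 0 < L' by rewrite ltr_wpDl.
have LL' : L <= L' by rewrite (le_trans (ler_norm L))// lerDl.
have -> : (fun t => (D t)%:E) = (EFin \o D) \_ `[- L', L'].
  apply/funext => t; rewrite patchE; case: ifPn => //; rewrite notin_setE/= in_itv/= -ler_norml => /negP.
  by rewrite -ltNge => /ltW h; rewrite D0// (le_trans LL').
rewrite -integral_mkcond.
have FL : F L' = 0 by apply: F0; rewrite gtr0_norm.
have FNL : F (- L') = 0 by apply: F0; rewrite normrN gtr0_norm.
rewrite (@continuous_FTC2 _ D F)//.
- by rewrite FL FNL -EFinB subrr.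
- by rewrite -subr_gt0 opprK addr_gt0.
- exact: continuous_subspaceT.
- split=> //.
  + apply: cvg_at_right_filter; apply: differentiable_continuous; apply/derivable1_diffP.
    by have [] := dF (- L').
  + apply: cvg_at_left_filter; apply: differentiable_continuous; apply/derivable1_diffP.
    by have [] := dF L'.
- by move=> t _; rewrite derive1E; have [] := dF t.
Qed.

Lemma continuous_line3 (D : R * R * R -> R) (j : 'I_3) (x : R * R * R) :
  continuous D -> continuous (fun t : R => D (t *: basis3 j + x)).
Proof.
move=> cD t; apply: (@continuous_comp _ _ _ (fun t : R => t *: basis3 j + x) D); last exact: cD.
by apply: continuousD; [exact: scalel_continuous|exact: cst_continuous].
Qed.

Lemma ord3_case (P : 'I_3 -> Prop) : P 0 -> P 1 -> P 2 -> forall j, P j.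
Proof.
move=> p0 p1 p2 -[[|[|[|//]]] h].
- by rewrite (_ : Ordinal h = 0)//; exact: val_inj.
- by rewrite (_ : Ordinal h = 1)//; exact: val_inj.
- by rewrite (_ : Ordinal h = 2)//; exact: val_inj.
Qed.

Lemma integral_line3_eq0 (F D : R * R * R -> R) (L : R) (j : 'I_3) (x : R * R * R):
  (forall x, is_derive x (basis3 j) F (D x)) -> continuous D ->
  (forall x, ~ cube 0 L x -> F x = 0) -> (forall x, ~ cube 0 L x -> D x = 0) ->
  (\int[lebesgue_measure]_t (D (t *: basis3 j + x))%:E = 0)%E.
Proof.
move=> dF cD F0 D0.
(* Beyond this bound |t + x_j| >= |t| - |x_j| >= L; adding all three coordinates of x serves every j
   at once. *)
pose L' := L + (`|x.1.1| + `|x.1.2| + `|x.2|).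
have out t : L' <= `|t| -> ~ cube 0 L (t *: basis3 j + x).
  move=> Lt /cubeE/=; rewrite !subr0 => -[].
  have h (y : R) : `|t + y| < L -> `|t| < L + `|y|.
    by move=> h; rewrite -[t](addrK y) (le_lt_trans (ler_normB _ _))// ltrD2r.
  have [[n1 n2] n3] := (normr_ge0 x.1.1, normr_ge0 x.1.2, normr_ge0 x.2).
  move: Lt; rewrite /L'; elim/ord3_case: j {dF} => /=; rewrite ?eqxx /= ?scaler1 ?scaler0 ?add0r.
  - by move=> ? /h ?; lra.
  - by move=> ? _ /h ?; lra.
  - by move=> ? _ _ /h ?; lra.
apply: (@integral_derive_eq0 (fun t => F (t *: basis3 j + x)) _ L').
- by move=> t; apply/is_derive_line.
- exact: continuous_line3.
- by move=> t /out /F0.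
- by move=> t /out /D0.
Qed.

(** Fubini with the variable j innermost. The directions 0 and 1 need a second Fubini in the
    horizontal planes, hence the integrability of each slice. The lines start at points with j-th
    coordinate 0, so that the parameter is that coordinate. *)
Lemma integral_lines3_eq0 (f : R * R * R -> R) (j : 'I_3) :
  mu3.-integrable setT (EFin \o f) ->
  (forall t, mu2.-integrable setT (fun p => (f (p, t))%:E)) ->
  (forall x, \int[leb]_t (f (t *: basis3 j + x))%:E = 0)%E ->
  (\int[mu3]_x (f x)%:E = 0)%E.
Proof.
move=> i3 i2 line.
have [j2|j2] := eqVneq j 2.
  rewrite integral12_mu3// integral0_eq// => -[p q] _.
  rewrite -[RHS](line (p, q, 0)).
  apply: eq_integral => t _; congr (f _)%:E.
  by rewrite j2 /basis3 /=; congr (_, _, _) => /=; rewrite ?scaler0 ?[t *: 1]mulr1 ?add0r ?addr0.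
rewrite integral21_mu3// integral0_eq// => t _ /=.
have [j1|j1] := eqVneq j 1.
  rewrite integral12_mu2// integral0_eq// => p _.
  rewrite -[RHS](line (p, 0, t)).
  apply: eq_integral => q _; congr (f _)%:E.
  by rewrite j1 /basis3 /=; congr (_, _, _) => /=; rewrite ?scaler0 ?[q *: 1]mulr1 ?add0r ?addr0.
have j0 : j = 0 by move: j1 j2; elim/ord3_case: (j).
rewrite integral21_mu2// integral0_eq// => q _.
rewrite -[RHS](line (0, q, t)).
apply: eq_integral => p _; congr (f _)%:E.
by rewrite j0 /basis3 /=; congr (_, _, _) => /=; rewrite ?scaler0 ?[p *: 1]mulr1 ?add0r ?addr0.
Qed.

Lemma continuous_cube_bounded (D : R * R * R -> R) (L : R) :
  continuous D -> (forall x, ~ cube 0 L x -> D x = 0) -> exists M, forall x, `|D x| <= M.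
Proof.
move=> cD D0.
pose I : set R := [set` `[- `|L|, `|L|]].
have cI : compact I by exact: segment_compact.
have cB : compact (I `*` I `*` I) by apply: compact_setX => //; exact: compact_setX.
have /compact_bounded[M [_ hM]] : compact (D @` (I `*` I `*` I)).
  by apply: continuous_compact => //; exact: continuous_subspaceT.
exists (`|M| + 1) => x.
have [xL|xL] := pselect (cube 0 L x); last first.
  by rewrite D0// normr0 addr_ge0.
apply: (hM (`|M| + 1)); first by rewrite (le_lt_trans (ler_norm M))// ltrDl.
exists x => //; case/cubeE: xL => /=; rewrite !subr0 => h1 h2 h3.
have h (t : R) : `|t| < L -> I t.
  by move=> /ltW tL; rewrite /I/= in_itv/= -ler_norml (le_trans tL)// ler_norm.
by split; [split|]; exact: h.
Qed.

Lemma integrable_continuous_cube (D : R * R * R -> R) (L : R) :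
  continuous D -> (forall x, ~ cube 0 L x -> D x = 0) ->
  mu3.-integrable setT (EFin \o D).
Proof.
move=> cD D0; have [M DM] := continuous_cube_bounded cD D0.
exact: integrable_cube (continuous_measurable3 cD) DM D0.
Qed.

(** Integration by parts in the form used below, where F will be a combination of products of kernel
    components and test functions. *)
Lemma integral3_derive_eq0 (F D : R * R * R -> R) (L : R) (j : 'I_3) :
  (forall x, is_derive x (basis3 j) F (D x)) -> continuous D ->
  (forall x, ~ cube 0 L x -> F x = 0) -> (forall x, ~ cube 0 L x -> D x = 0) ->
  (\int[mu3]_x (D x)%:E = 0)%E.
Proof.
move=> dF cD F0 D0; have [M DM] := continuous_cube_bounded cD D0.
apply: (@integral_lines3_eq0 _ j) => [|t|x].
- exact: integrable_continuous_cube cD D0.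
- have bA : measurable (ball (0 : R) `|L| `*` ball (0 : R) `|L| : set (M1 * M1)).
    by apply: measurableX; exact: measurable_ball.
  apply: (@integrable_bounded_support R _ _ mu2 (ball 0 `|L| `*` ball 0 `|L|) (fun p => D (p, t)) M) => //.
  + by rewrite [ltLHS]mu2_square// ltry.
  + apply: (measurableT_comp (f := D : M3 -> R)); first exact: continuous_measurable3.
    exact: measurable_fun_pair.
  + move=> p np; apply: D0 => /cubeE[h1 h2 _]; apply: np.
    by split; rewrite /ball/= distrC (lt_le_trans _ (ler_norm L)).
- exact: integral_line3_eq0 F0 D0.
Qed.
End DirectionalDerivative.

(** * The regularised kernel: derivatives, curl, divergence and size *)

Section Kernel.
Variable R : realType.
Implicit Types (x y z : R * R * R) (i j : 'I_3).

Definition coord j y : R := if j == 0 then y.1.1 else if j == 1 then y.1.2 else y.2.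

Lemma coord_basis3 i j : coord j (@basis3 R i) = (i == j)%:R.
Proof. by elim/ord3_case: i; elim/ord3_case: j. Qed.

Lemma coord_linear j (t : R) y z : coord j (t *: y + z) = t * coord j y + coord j z.
Proof. by rewrite /coord; case: eqP => // _; case: eqP. Qed.

Lemma continuous_coord j : continuous (coord j).
Proof.
have c11 : continuous (fun y : R * R * R => y.1.1).
  by move=> y; apply: (@continuous_comp _ _ _ fst fst) => //; exact: cvg_fst.
have c12 : continuous (fun y : R * R * R => y.1.2).
  by move=> y; apply: (@continuous_comp _ _ _ fst snd); [exact: cvg_fst|exact: cvg_snd].
have c2 : continuous (fun y : R * R * R => y.2) by move=> y; exact: cvg_snd.
by rewrite /coord; elim/ord3_case: j.
Qed.

Lemma is_derive_coord j y (v : R * R * R) : is_derive y v (coord j) (coord j v).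
Proof.
have -> : y = 0 *: v + y by rewrite scale0r add0r.
apply/is_derive_line.
have -> : (fun t => coord j (t *: v + y)) = (fun t : R => t * coord j v + coord j y).
  by apply/funext => t; rewrite coord_linear.
by apply: is_derive_eq; rewrite !(scaler0, addr0, add0r) [LHS]mulr1.
Qed.

Definition dcoord x j y := coord j y - coord j x.

Definition sqdist x y : R := (y.1.1 - x.1.1) ^+ 2 + (y.1.2 - x.1.2) ^+ 2 + (y.2 - x.2) ^+ 2.

Variables (x : R * R * R) (e : R).
Hypothesis e0 : 0 < e.

Local Notation z := (dcoord x).

(** The regularised distance from x: it is at least e, so its inverse powers stay differentiable at
    y = x. *)
Definition rdist y := Num.sqrt (sqdist x y + e ^+ 2).

Lemma sqdist_ge0 y : 0 <= sqdist x y.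
Proof. by rewrite /sqdist !addr_ge0 ?sqr_ge0. Qed.

Lemma rdist_gt0 y : 0 < rdist y.
Proof. by rewrite sqrtr_gt0 ltr_wpDl ?sqdist_ge0// exprn_gt0. Qed.

Lemma rdist_sqr y : rdist y ^+ 2 = sqdist x y + e ^+ 2.
Proof. by rewrite sqr_sqrtr// addr_ge0 ?sqdist_ge0// sqr_ge0. Qed.

Lemma sqdistE y : sqdist x y = z 0 y ^+ 2 + z 1 y ^+ 2 + z 2 y ^+ 2.
Proof. by []. Qed.

Lemma is_derive_z i j y : is_derive y (basis3 i) (z j) (i == j)%:R.
Proof.
have h := is_derive_coord j y (basis3 i).
apply: is_derive_eq; by rewrite /dcoord coord_basis3 subr0.
Qed.

Lemma is_derive_sqdist j y : is_derive y (basis3 j) (sqdist x) (2 * z j y).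
Proof.
have -> : sqdist x = z 0 * z 0 + z 1 * z 1 + z 2 * z 2.
  by apply/funext => w; rewrite sqdistE !expr2.
apply: is_derive_eq.
  apply: is_deriveD; first apply: is_deriveD; apply: is_deriveM; exact: is_derive_z.
rewrite /GRing.scale /=.
by elim/ord3_case: j => /=; ring.
Qed.

Lemma is_derive_rdist j y : is_derive y (basis3 j) rdist (z j y / rdist y).
Proof.
have r0 := rdist_gt0 y.
have h : is_derive y (basis3 j) (fun y => sqdist x y + e ^+ 2) (2 * z j y).
  have h' := is_derive_sqdist j y.
  rewrite -[X in is_derive _ _ _ X]addr0.
  exact: (@is_deriveD _ _ _ (sqdist x) (cst (e ^+ 2)) y (basis3 j) _ _ h' (is_derive_cst _ _ _)).

apply: (@is_derive_eq _ _ _ _ _ _ _ ((2 * rdist y)^-1 * (2 * z j y))).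
  apply: is_derive_dir_comp h.
  by apply: is_derive1_sqrt; rewrite ltr_wpDl ?sqdist_ge0// exprn_gt0.
by field; rewrite lt0r_neq0.
Qed.

Definition irdist y := (rdist y)^-1.

Lemma is_derive_irdist j y : is_derive y (basis3 j) irdist (- (z j y * irdist y ^+ 3)).
Proof.
have r0 := rdist_gt0 y; rewrite /irdist.
apply: (@is_derive_eq _ _ _ _ _ _ _ ((- rdist y ^- 2) * (z j y / rdist y))).
  apply: (@is_derive_dir_comp _ _ GRing.inv rdist); last exact: is_derive_rdist.
  rewrite -[X in is_derive _ _ _ X]mulr1.
  by apply: (@is_deriveV R id (rdist y) 1 1); rewrite lt0r_neq0.
by field; rewrite lt0r_neq0.
Qed.

(** Minus the j-th partial derivative of the softened Newtonian potential [irdist], which is why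
    [dker], minus its Hessian, is symmetric. *)
Definition ker j y := z j y * irdist y ^+ 3.

Definition dker i j y := (i == j)%:R * irdist y ^+ 3 - 3 * z i y * z j y * irdist y ^+ 5.

Lemma is_derive_ker i j y : is_derive y (basis3 i) (ker j) (dker i j y).
Proof.
have -> : ker j = z j * (irdist * irdist * irdist).
  by apply/funext => w; rewrite /ker !exprS expr0 mulr1 -mulrA.
apply: is_derive_eq.
  apply: is_deriveM; first exact: is_derive_z.
  apply: is_deriveM; last exact: is_derive_irdist.
  by apply: is_deriveM; exact: is_derive_irdist.
rewrite /dker /GRing.scale /= !fctE.
by ring.
Qed.

Lemma continuous_z j : continuous (z j).
Proof.
by move=> y; apply: continuousB; [exact: continuous_coord|exact: cst_continuous].
Qed.

Lemma continuous_irdist : continuous irdist.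
Proof.
move=> y; apply: continuousV; first by rewrite lt0r_neq0// rdist_gt0.
apply: (@continuous_comp _ _ _ (fun y => sqdist x y + e ^+ 2) Num.sqrt); last exact: sqrt_continuous.
apply: continuousD; last exact: cst_continuous.
have -> : sqdist x = z 0 * z 0 + z 1 * z 1 + z 2 * z 2.
  by apply/funext => w; rewrite sqdistE !expr2.
by apply: continuousD; first apply: continuousD; apply: continuousM; exact: continuous_z.
Qed.

Lemma continuous_ker j : continuous (ker j).
Proof.
move=> y; apply: continuousM; first exact: continuous_z.
by apply: (@continuous_comp _ _ _ irdist (fun t => t ^+ 3)); [exact: continuous_irdist|exact: exprn_continuous].
Qed.

Lemma continuous_dker i j : continuous (dker i j).
Proof.
have c n : continuous (fun y => irdist y ^+ n).
  by move=> y; apply: (@continuous_comp _ _ _ irdist (fun t => t ^+ n)); [exact: continuous_irdist|exact: exprn_continuous].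
move=> y; apply: (@continuousB _ _ _ (fun y => (i == j)%:R * irdist y ^+ 3)
  (fun y => 3 * z i y * z j y * irdist y ^+ 5)); apply: continuousM; try exact: c; first exact: cst_continuous.
apply: continuousM; last exact: continuous_z.
by apply: continuousM; [exact: cst_continuous|exact: continuous_z].
Qed.

(** Minus the Laplacian of [irdist], that is, a multiple of the Plummer density; this is m in the
    overview. *)
Definition divker y := 3 * e ^+ 2 * irdist y ^+ 5.

Lemma dker_curl i j y : dker i j y = dker j i y.
Proof. by rewrite /dker eq_sym; ring. Qed.

Lemma dker_trace y : dker 0 0 y + dker 1 1 y + dker 2 2 y = divker y.
Proof.
have r0 := rdist_gt0 y.
have : irdist y ^+ 2 * (sqdist x y + e ^+ 2) = 1.
  by rewrite -rdist_sqr /irdist -exprMn mulVf ?expr1n// lt0r_neq0.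
rewrite /dker /divker sqdistE !eqxx !mulr1n => h.
set c := irdist y in h *.
(* Raises the cubic term to degree 5 with c^2 (|z|^2 + e^2) = 1; then 3 |z|^2 c^5 cancels and only
   the e^2 part survives. *)
have -> : c ^+ 3 = c ^+ 3 * (c ^+ 2 * (z 0 y ^+ 2 + z 1 y ^+ 2 + z 2 y ^+ 2 + e ^+ 2)) by rewrite h mulr1.
by ring.
Qed.

(* At y = x both sides are 0, because 0^-1 = 0. *)
Lemma ker_le j y : `|ker j y| <= (sqdist x y)^-1.
Proof.
have r0 := rdist_gt0 y.
have [s0|s0] := eqVneq (sqdist x y) 0.
  have zj : z j y = 0.
    move: s0; rewrite sqdistE => s0.
    have := (sqr_ge0 (z 0 y), sqr_ge0 (z 1 y), sqr_ge0 (z 2 y)).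
    move=> [[? ?] ?]; apply/eqP; rewrite -sqrf_eq0; apply/eqP.
    by elim/ord3_case: j; lra.
  by rewrite /ker zj mul0r normr0 s0 invr0.
have sp : 0 < sqdist x y by rewrite lt_neqAle eq_sym s0 sqdist_ge0.
have zr : `|z j y| <= rdist y.
  rewrite -(ler_pXn2r (n := 2)) ?nnegrE ?normr_ge0 ?(ltW r0)// real_normK ?num_real// rdist_sqr sqdistE.
  have := (sqr_ge0 (z 0 y), sqr_ge0 (z 1 y), sqr_ge0 (z 2 y), sqr_ge0 e).
  by move=> [[[? ?] ?] ?]; elim/ord3_case: j; lra.
have i0 : 0 < irdist y by rewrite invr_gt0.
rewrite /ker normrM [X in _ * X]ger0_norm ?exprn_ge0 ?(ltW i0)//.
apply: (@le_trans _ _ (irdist y ^+ 2)).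
  rewrite [leLHS](_ : _ = (`|z j y| * irdist y) * irdist y ^+ 2); last by rewrite exprS mulrA.
  by rewrite ler_piMl ?exprn_ge0 ?(ltW i0)// ler_pdivrMr// mul1r.
rewrite /irdist exprVn lef_pV2 ?posrE ?exprn_gt0// rdist_sqr lerDl sqr_ge0 //.
Qed.

Lemma divker_ge0 y : 0 <= divker y.
Proof. by rewrite /divker !mulr_ge0 ?exprn_ge0 ?invr_ge0 ?(ltW (rdist_gt0 y)) ?(ltW e0). Qed.

(** Each of the three coordinates contributes at most e^2, so [rdist] is at most 2e, and 3 e^2 /
    (2e)^5 = 3 / (32 e^3). Times the volume 8 e^3 this is 3/4 for every e, which stands in for the
    mass of m. *)
Lemma divker_cube_ge y : cube x e y -> 3 / 32 / e ^+ 3 <= divker y.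
Proof.
move=> /cubeE[h1 h2 h3]; have r0 := rdist_gt0 y.
have e2 : 0 < 2 * e by rewrite mulr_gt0.
have hs (t : R) : `|t| < e -> t ^+ 2 <= e ^+ 2.
  by move=> te; rewrite -(real_normK (num_real t)) ler_pXn2r ?nnegrE ?normr_ge0 ?(ltW te) ?(ltW e0).
have hr : rdist y <= 2 * e.
  rewrite -(ler_pXn2r (n := 2)) ?nnegrE ?(ltW r0) ?(ltW e2)// rdist_sqr /sqdist exprMn.
  by have := (hs _ h1, hs _ h2, hs _ h3) => -[[? ?] ?]; lra.
rewrite /divker.
apply: (@le_trans _ _ (3 * e ^+ 2 * (2 * e) ^- 5)).
  by rewrite le_eqVlt; apply/orP; left; apply/eqP; field; rewrite lt0r_neq0.
rewrite ler_pM2l ?mulr_gt0 ?exprn_gt0// /irdist exprVn lef_pV2 ?posrE ?exprn_gt0 ?rdist_gt0 ?mulr_gt0//.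
by rewrite ler_pXn2r ?nnegrE ?(ltW r0) ?(ltW e2).
Qed.

(** Some coordinate of y - x is at least d in modulus. For fixed d the bound is O(e^2), which makes
    the region away from x negligible. *)
Lemma divker_out_le y d : 0 < d -> ~ cube x d y -> divker y <= 3 * e ^+ 2 / d ^+ 5.
Proof.
move=> d0 ny; have r0 := rdist_gt0 y.
have hr : d <= rdist y.
  rewrite leNgt; apply/negP => rd; apply: ny; apply/cubeE.
  have hs (t : R) : t ^+ 2 <= rdist y ^+ 2 -> `|t| < d.
    move=> te; apply: le_lt_trans rd.
    by rewrite -(ler_pXn2r (n := 2)) ?nnegrE ?normr_ge0 ?(ltW r0)// real_normK ?num_real.
  have := (sqr_ge0 (y.1.1 - x.1.1), sqr_ge0 (y.1.2 - x.1.2), sqr_ge0 (y.2 - x.2), sqr_ge0 e).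
  by move=> [[[? ?] ?] ?]; split; apply: hs; rewrite rdist_sqr /sqdist; lra.
rewrite /divker ler_pM2l ?mulr_gt0 ?exprn_gt0// /irdist exprVn lef_pV2 ?posrE ?exprn_gt0 ?rdist_gt0//.
by rewrite ler_pXn2r ?nnegrE ?(ltW r0) ?(ltW d0).
Qed.
End Kernel.

(** * The integral identity for the Dirac operator in real components *)

Section Bound.
Variable R : realType.
Local Notation R3 := (R * R * R)%type.
Local Notation M1 := (measurableTypeR R).
Local Notation M3 := (M1 * M1 * M1)%type.
Implicit Types (u v w : R3 -> R) (x y : R3) (i j : 'I_3).

(** Integrability is bundled with the value, so that identities and inequalities between integrals
    combine without side conditions. *)
Definition has_int (f : R3 -> R) (r : R) :=
  mu3.-integrable setT (EFin \o f : M3 -> \bar R) /\ (\int[mu3]_x (f x)%:E = r%:E)%E.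

Lemma has_intD f g r s : has_int f r -> has_int g s -> has_int (fun x => f x + g x) (r + s).
Proof.
move=> [if_ fr] [ig gs]; split.
  exact: (@integrableD _ _ _ mu3 setT measurableT (EFin \o f) (EFin \o g)).
by rewrite EFinD -fr -gs; exact: (@integralD_EFin _ _ _ mu3 setT).
Qed.

Lemma has_intZ c f r : has_int f r -> has_int (fun x => c * f x) (c * r).
Proof.
move=> [if_ fr]; split; first exact: (@integrableZl _ _ _ mu3 setT measurableT c (EFin \o f)).
by rewrite EFinM -fr; exact: (@integralZl _ _ _ mu3 setT measurableT (EFin \o f)).
Qed.

Lemma has_int_cube x r : 0 <= r -> has_int (\1_(cube x r)) (8 * r ^+ 3).
Proof.
move=> r0; have mc : measurable (cube x r : set M3) := measurable_cube x r.
have E : (\int[mu3]_y (\1_(cube x r) y)%:E = (8 * r ^+ 3)%:E)%E.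
  by rewrite (integral_indic (@mu3 R) measurableT mc) setIT; exact: mu3_cube.
split=> //; apply/integrableP; split.
  by apply/measurable_EFinP; exact: measurable_indic.
suff -> : (\int[mu3]_y `|(EFin \o \1_(cube x r)) y| = (8 * r ^+ 3)%:E)%E by rewrite ltry.
by rewrite -E; apply: eq_integral => y _ /=; rewrite ger0_norm.
Qed.

Lemma has_int_le f g r s : has_int f r -> has_int g s -> (forall x, f x <= g x) -> r <= s.
Proof.
move=> [if_ fr] [ig gs] fg; rewrite -lee_fin -fr -gs.
by apply: (@le_integral _ _ _ mu3 setT) => // x _ /=; rewrite lee_fin.
Qed.

(** C^1 functions supported in a fixed cube. The class is closed under negation, as the sign changes
    in the symmetries of the Dirac operator require. *)
Definition test_fun L u :=
  [/\ continuous u, forall j, continuous (partial j u), forall j x, derivable u x (basis3 j) &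
    forall x, ~ cube 0 L x -> u x = 0 /\ forall j, partial j u x = 0].

Lemma test_funN L u : test_fun L u -> test_fun L (- u).
Proof.
have pN j x : derivable u x (basis3 j) -> partial j (- u) x = - partial j u x.
  by move=> h; rewrite /partial deriveN.
move=> [cu cdu du u0]; split.
- by move=> x; apply: continuousN; exact: cu.
- move=> j; have -> : partial j (- u) = - partial j u by apply/funext => x; rewrite pN.
  by move=> x; apply: continuousN; exact: cdu.
- by move=> j x; exact: derivableN.
- by move=> x /u0 [h1 h2]; split=> [|j]; rewrite ?pN// ?h2 ?oppr0// fctE h1 oppr0.
Qed.

Lemma partialN L u j x : test_fun L u -> partial j (- u) x = - partial j u x.
Proof. by case=> _ _ h _; rewrite /partial deriveN. Qed.

Section Rep.
Variables (L : R) (x : R3) (e : R).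
Hypothesis e0 : 0 < e.
Local Notation K := (ker x e).
Local Notation dK := (dker x e).

(** By the product rule the integrand is the i-th partial derivative of K_p u + s K_q v + t K_r w.
    The identity below has nine such products, three for each direction. *)
Lemma has_int_div i p q r (s t : R) u v w : test_fun L u -> test_fun L v -> test_fun L w ->
  has_int (fun y => (dK i p y * u y + K p y * partial i u y)
    + s * (dK i q y * v y + K q y * partial i v y)
    + t * (dK i r y * w y + K r y * partial i w y)) 0.
Proof.
move=> [cu cdu du u0] [cv cdv dv v0] [cw cdw dw w0].
set D := (X in has_int X).
have cM (f g : R3 -> R) : continuous f -> continuous g -> continuous (fun y : R3 => f y * g y : R).
  by move=> cf cg y; apply: continuousM; [exact: cf|exact: cg].
have cA (f g : R3 -> R) : continuous f -> continuous g -> continuous (fun y : R3 => f y + g y : R).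
  by move=> cf cg y; apply: continuousD; [exact: cf|exact: cg].
have cs (k : R) : continuous (fun _ : R3 => k) by move=> y; exact: cst_continuous.
have c (p' : 'I_3) u' (h : continuous u') (dh : continuous (partial i u')) :=
  cA _ _ (cM _ _ (@continuous_dker _ x e e0 i p') h) (cM _ _ (@continuous_ker _ x e e0 p') dh).
have cD : continuous D.
  exact: (cA _ _ (cA _ _ (c p _ cu (cdu i)) (cM _ _ (cs s) (c q _ cv (cdv i))))
    (cM _ _ (cs t) (c r _ cw (cdw i)))).
have D0 y : ~ cube 0 L y -> D y = 0.
  by rewrite /D => h; have [[-> ->] [-> ->] [-> ->]] := And3 (u0 _ h) (v0 _ h) (w0 _ h); ring.
split; first exact: integrable_continuous_cube cD D0.
pose F := K p * u + cst s * (K q * v) + cst t * (K r * w).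
have F0 y : ~ cube 0 L y -> F y = 0.
  by move=> ny; have [[h1 _] [h2 _] [h3 _]] := And3 (u0 _ ny) (v0 _ ny) (w0 _ ny); rewrite /F !fctE h1 h2 h3; ring.
have dF y : is_derive y (basis3 i) F (D y).
  have [hp hq hr] := And3 (is_derive_ker x e0 i p y) (is_derive_ker x e0 i q y) (is_derive_ker x e0 i r y).
  have [hu hv hw] := And3 (derivableP (du i y)) (derivableP (dv i y)) (derivableP (dw i y)).
  refine (is_derive_eq (is_deriveD (is_deriveD (is_deriveM hp hu)
    (is_deriveM (is_derive_cst s _ _) (is_deriveM hq hv)))
    (is_deriveM (is_derive_cst t _ _) (is_deriveM hr hw))) _).
  by rewrite /D /GRing.scale /= /partial; ring.
exact: integral3_derive_eq0 dF cD F0 D0.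
Qed.

Variables (a b c d : R3 -> R).
Hypotheses (ta : test_fun L a) (tb : test_fun L b) (tc : test_fun L c) (td : test_fun L d).

(* For f = (a + i b, c + i d) these are, up to sign, three of the four real
   components of sigma_p f. The substitutions (b, -a, d, -c), (c, -d, -a, b) and
   (d, c, -b, -a) for (a, b, c, d) permute those components up to sign, so a bound
   on a gives one on b, c and d. *)
Definition dirac1 y := partial 2 a y + partial 0 c y + partial 1 d y.
Definition dirac2 y := partial 0 a y - partial 1 b y - partial 2 c y.
Definition dirac3 y := partial 1 a y + partial 0 b y - partial 2 d y.

(** This is the real part of the first component of (sigma.K)(sigma.grad f) + m f. After expansion
    the derivatives of K multiply [a] by the trace of [dker], which is m, and each of [b], [c], [d]
    by a difference [dK i j - dK j i], which is 0. *)
Lemma has_int_rep :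
  has_int (fun y => K 2 y * dirac1 y + K 0 y * dirac2 y + K 1 y * dirac3 y + divker x e y * a y) 0.
Proof.
(* The fields differentiated in directions 0, 1, 2 are K_0 a + K_2 c + K_1 b, K_1 a + K_2 d - K_0 b
   and K_2 a - K_0 c - K_1 d. *)
have := has_intD (has_intD (has_int_div 0 0 2 1 1 1 ta tc tb) (has_int_div 1 1 2 0 1 (-1) ta td tb))
  (has_int_div 2 2 0 1 (-1) (-1) ta tc td).
rewrite !addr0; congr has_int; apply/funext => y.
rewrite -(dker_trace x e0 y) (dker_curl x e 1 0) (dker_curl x e 2 0) (dker_curl x e 2 1).
rewrite /dirac1 /dirac2 /dirac3.
move: (dK 0 0 y) (dK 1 1 y) (dK 2 2 y) (dK 0 1 y) (dK 0 2 y) (dK 1 2 y) (K 0 y) (K 1 y) (K 2 y)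
  (a y) (b y) (c y) (d y) (partial 0 a y) (partial 1 a y) (partial 2 a y) (partial 0 b y)
  (partial 1 b y) (partial 2 c y) (partial 0 c y) (partial 1 d y) (partial 2 d y).
by move=> *; ring.
Qed.

End Rep.
End Bound.

(** * A one-sided pointwise bound on a real component *)

Section Pointwise.
Variable R : realType.
Local Notation R3 := (R * R * R)%type.
Local Notation M1 := (measurableTypeR R).
Local Notation M3 := (M1 * M1 * M1)%type.
Implicit Types (u v w : R3 -> R) (x y : R3) (i j : 'I_3).

(** Inversion is discontinuous at 0, where 0^-1 = 0; on nonnegative values it agrees with the
    measurable power of exponent -1. *)
Lemma measurable_fun_inv_ge0 d (T : measurableType d) (f : T -> R) :
  (forall p, 0 <= f p) -> measurable_fun setT f -> measurable_fun setT (fun p => (f p)^-1).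
Proof.
move=> f0 mf.
rewrite (_ : (fun p => _) = (fun p => f p `^ (-1))).
  exact: (measurableT_comp (measurable_powR (-1)) mf).
by apply/funext => p; rewrite powR_inv1.
Qed.

Lemma continuous_sqdist x : continuous (sqdist x).
Proof.
have -> : sqdist x = dcoord x 0 * dcoord x 0 + dcoord x 1 * dcoord x 1 + dcoord x 2 * dcoord x 2.
  by apply/funext => w; rewrite sqdistE !expr2.
move=> y.
by apply: continuousD; first apply: continuousD; apply: continuousM; exact: continuous_z.
Qed.

Variables (L : R) (a b c d : R3 -> R).
Hypotheses (ta : test_fun L a) (tb : test_fun L b) (tc : test_fun L c) (td : test_fun L d).
Local Notation A := (dirac1 a c d).
Local Notation B := (dirac2 a b c).
Local Notation C := (dirac3 a b d).

Definition dirac_norm y := `|A y| + `|B y| + `|C y|.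

Lemma continuous_dirac_norm : continuous dirac_norm.
Proof.
have [_ pa _ _] := ta; have [_ pb _ _] := tb; have [_ pc _ _] := tc; have [_ pd _ _] := td.
have cn (f : R3 -> R) : continuous f -> continuous (fun y => `|f y|).
  by move=> cf y; apply: (@continuous_comp _ _ _ f (fun t : R => `|t|)); [exact: cf|exact: norm_continuous].
have cA (f g : R3 -> R) : continuous f -> continuous g -> continuous (fun y : R3 => f y + g y : R).
  by move=> cf cg y; apply: continuousD; [exact: cf|exact: cg].
have cB (f g : R3 -> R) : continuous f -> continuous g -> continuous (fun y : R3 => f y - g y : R).
  by move=> cf cg y; apply: continuousB; [exact: cf|exact: cg].
exact: (cA _ _ (cA _ _ (cn _ (cA _ _ (cA _ _ (pa 2) (pc 0)) (pd 1)))
  (cn _ (cB _ _ (cB _ _ (pa 0) (pb 1)) (pc 2)))) (cn _ (cB _ _ (cA _ _ (pa 1) (pb 0)) (pd 2)))).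
Qed.

Lemma dirac_norm_ge0 y : 0 <= dirac_norm y.
Proof. by rewrite /dirac_norm !addr_ge0. Qed.

(** Adding the majorant to the identity [has_int_rep] leaves a function of integral r that is at
    least m a pointwise. The margin [eta] keeps [a] positive on a whole cube around x, where m
    contributes at least 3/4; the remaining loss is made at most [eta] by the choice of e. *)
Lemma test_fun_ge_bound x (r eta : R) : has_int (fun y => (sqdist x y)^-1 * dirac_norm y) r ->
  0 < eta -> eta < a x -> 3 / 4 * (a x - eta) <= r + eta.
Proof.
move=> hr eta0 ax.
have [ca _ _ a0] := ta.
have [M aM] : exists M, forall y, `|a y| <= M.
  by apply: (continuous_cube_bounded ca (L := L)) => y /a0[].
have M0 : 0 <= M by exact: le_trans (normr_ge0 _) (aM 0).
have [dl dl0 hd] : exists2 dl, 0 < dl & forall y, cube x dl y -> a x - eta <= a y.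
  have /nbhs_ballP[dl /= dl0 h] : nbhs x [set t | `|a x - a t| < eta].
    by have /cvgrPdist_lt/(_ eta eta0) := ca x.
  exists dl => // y /h /=.
  by move=> /ltW; rewrite ler_distl => /andP[_]; lra.
pose L' := `|L|.
(* e^2 W bounds the loss away from x: the bound on |a|, times that on m, times the volume of a cube
   containing the support. The added 1 makes W positive. *)
pose W := M * (3 / dl ^+ 5) * (8 * L' ^+ 3) + 1.
have dl5 : 0 <= 3 / dl ^+ 5 by rewrite divr_ge0// exprn_ge0// ltW.
have L30 : 0 <= 8 * L' ^+ 3 by rewrite mulr_ge0// exprn_ge0// normr_ge0.
have W0 : 0 < W by rewrite ltr_wpDl// mulr_ge0// mulr_ge0.
(* The three terms put the small cube inside the one where [a] is close to [a x], give e^2 <= e, and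
   give e W <= eta. *)
pose e := Num.min (Num.min dl 1) (eta / W).
have e0 : 0 < e by rewrite !lt_min dl0 ltr01 divr_gt0.
have ed : e <= dl by rewrite !ge_min lexx.
have e1 : e <= 1 by rewrite !ge_min lexx orbT.
have eW : e * W <= eta by rewrite -ler_pdivlMr// !ge_min lexx orbT.
have h1 := has_intZ ((a x - eta) * (3 / 32 / e ^+ 3)) (has_int_cube x (ltW e0)).
have h2 := has_intZ (- (M * (3 * e ^+ 2 / dl ^+ 5))) (has_int_cube 0 (normr_ge0 L)).
have h3 := has_intD (has_int_rep x e0 ta tb tc td) hr.
have := has_int_le (has_intD h1 h2) h3.
have -> : (a x - eta) * (3 / 32 / e ^+ 3) * (8 * e ^+ 3) = 3 / 4 * (a x - eta).
  by field; rewrite lt0r_neq0.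
move=> H; have {H} := H _; rewrite add0r => H.
suff : 3 / 4 * (a x - eta) + - (M * (3 * e ^+ 2 / dl ^+ 5)) * (8 * L' ^+ 3) <= r.
  have : (M * (3 * e ^+ 2 / dl ^+ 5)) * (8 * L' ^+ 3) <= eta.
    apply: le_trans eW; rewrite /W mulrDr mulr1.
    have e2 : e ^+ 2 <= e by rewrite expr2 ler_piMr// ltW.
    have : e ^+ 2 * (M * (3 / dl ^+ 5) * (8 * L' ^+ 3)) <= e * (M * (3 / dl ^+ 5) * (8 * L' ^+ 3)).
      by rewrite ler_wpM2r// mulr_ge0// mulr_ge0.
    by move: (ltW e0) => ?; lra.
  by lra.
apply: H => y.
have k0 : 0 <= (sqdist x y)^-1 by rewrite invr_ge0 sqdist_ge0.
have divker0 := divker_ge0 x e0 y.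
have kle j t : - ((sqdist x y)^-1 * `|t|) <= ker x e j y * t.
  rewrite lerNl (le_trans (ler_norm _))// normrN normrM ler_wpM2r//.
  exact: ker_le.
(* Within radius [dl] of x, [a] is positive and m has its lower bound on the smaller cube; farther
   away, [a] is at least -M, m is O(e^2), and outside the support both sides are controlled by [a] =
   0. *)
have : (a x - eta) * (3 / 32 / e ^+ 3) * \1_(cube x e) y +
    - (M * (3 * e ^+ 2 / dl ^+ 5)) * \1_(cube 0 L') y <= divker x e y * a y.
  have sub : cube x e y -> cube x dl y.
    by move=> /cubeE[q1 q2 q3]; apply/cubeE; split; exact: lt_le_trans ed.
  have T0 : 0 <= M * (3 * e ^+ 2 / dl ^+ 5) * \1_(cube 0 L') y.
    by rewrite mulr_ge0// mulr_ge0// divr_ge0 ?exprn_ge0 ?(ltW dl0)// mulr_ge0// exprn_ge0// ltW.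
  rewrite mulNr.
  have [yd|yd] := pselect (cube x dl y); last first.
    rewrite [X in _ * X - _]indicE memNset; last by move=> /sub.
    rewrite mulr0 sub0r.
    have [yL|yL] := pselect (cube 0 L y); last first.
      by rewrite (a0 _ yL).1 mulr0 oppr_le0.
    have yL' : cube 0 L' y.
      by move: yL => /cubeE[q1 q2 q3]; apply/cubeE; split; apply: lt_le_trans (ler_norm L).
    rewrite indicE mem_set// mulr1 lerNl -mulrN.
    apply: (@le_trans _ _ (divker x e y * M)).
      by rewrite ler_wpM2l// (le_trans _ (aM y))// -normrN ler_norm.
    by rewrite mulrC ler_wpM2l//; exact: divker_out_le.
  have aye := hd _ yd.
  apply: (@le_trans _ _ ((a x - eta) * (3 / 32 / e ^+ 3) * \1_(cube x e) y)); first by rewrite gerBl.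
  rewrite indicE; have [ye|ye] := pselect (cube x e y).
    rewrite mem_set// mulr1 mulrC ler_pM//; last exact: divker_cube_ge.
      by rewrite divr_ge0 ?exprn_ge0 ?(ltW e0).
    by lra.
  by rewrite memNset// mulr0 mulr_ge0//; lra.
move=> /le_trans; apply.
rewrite /dirac_norm; move: (kle 2 (A y)) (kle 0 (B y)) (kle 1 (C y)).
move: (A y) (B y) (C y) (divker x e y * a y) => p q r' m; rewrite !mulrDr.
move: (ker x e 2 y * p) (ker x e 0 y * q) (ker x e 1 y * r').
move: ((sqdist x y)^-1 * `|p|) ((sqdist x y)^-1 * `|q|) ((sqdist x y)^-1 * `|r'|).
by clear=> *; lra.
Qed.

Lemma test_fun_le x :
  ((a x)%:E <= (4 / 3)%:E * \int[mu3]_y ((sqdist x y)^-1 * dirac_norm y)%:E)%E.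
Proof.
set f := fun y => (sqdist x y)^-1 * dirac_norm y.
have f0 y : 0 <= f y by rewrite mulr_ge0 ?dirac_norm_ge0// invr_ge0 sqdist_ge0.
have I0 : (0 <= \int[mu3]_y (f y)%:E)%E by apply: integral_ge0 => y _; rewrite lee_fin.
have mf : measurable_fun setT (f : M3 -> R).
  apply: measurable_funM; last exact: continuous_measurable3 continuous_dirac_norm.
  apply: measurable_fun_inv_ge0; first exact: sqdist_ge0.
  exact: continuous_measurable3 (@continuous_sqdist x).
have [Ioo|Ioo] := eqVneq (\int[mu3]_y (f y)%:E)%E +oo%E.
  by rewrite Ioo gt0_muley ?leey// lte_fin.
have If : (\int[mu3]_y (f y)%:E)%E \is a fin_num by rewrite ge0_fin_numE// ltey.
have hI : has_int f (fine (\int[mu3]_y (f y)%:E)%E).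
  split; last by rewrite fineK.
  apply/integrableP; split; first exact/measurable_EFinP.
  suff -> : (\int[mu3]_y `|(EFin \o f) y| = \int[mu3]_y (f y)%:E)%E by rewrite ltey.
  by apply: eq_integral => y _ /=; rewrite ger0_norm.
rewrite -(fineK If) -EFinM lee_fin.
have r0 := fine_ge0 I0; move: r0 hI; move: (fine _) => r r0 hI.
apply/ler_addgt0Pr => eta eta0.
(* With margin eta/3 the previous bound reads a x <= 4/3 r + 7/9 eta, within the allowed eta; if a x
   <= eta/3, then r >= 0 is enough. *)
have e30 : 0 < eta / 3 by rewrite divr_gt0.
have [h|h] := ltP (eta / 3) (a x); last by lra.
by have := test_fun_ge_bound hI e30 h; lra.
Qed.
End Pointwise.

(** * Absolute values by sign symmetry *)

Section Abs.
Variable R : realType.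
Local Notation R3 := (R * R * R)%type.
Local Notation M1 := (measurableTypeR R).
Local Notation M3 := (M1 * M1 * M1)%type.
Implicit Types (u v w : R3 -> R) (x y : R3) (i j : 'I_3).

Lemma dirac_normN L (a b c d : R3 -> R) y : test_fun L a -> test_fun L b -> test_fun L c -> test_fun L d ->
  dirac_norm (- a) (- b) (- c) (- d) y = dirac_norm a b c d y.
Proof.
move=> ta tb tc td; rewrite /dirac_norm /dirac1 /dirac2 /dirac3.
rewrite !(partialN _ _ ta) !(partialN _ _ tb) !(partialN _ _ tc) !(partialN _ _ td).
by congr (_ + _ + _); rewrite -normrN; congr (`|_|); rewrite !opprD !opprK.
Qed.

(** Changing the sign of all four functions preserves [dirac_norm], so the one-sided bound controls
    [a] from below too. [N] is kept abstract so that one majorant serves all four real components;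
    the 2 turns 4/3 into 8/3. *)
Lemma test_fun_abs_le L (a b c d N : R3 -> R) x :
  test_fun L a -> test_fun L b -> test_fun L c -> test_fun L d ->
  measurable_fun setT (N : M3 -> R) -> (forall y, dirac_norm a b c d y <= 2 * N y) ->
  (`|a x|%:E <= (8 / 3)%:E * \int[mu3]_y ((sqdist x y)^-1 * N y)%:E)%E.
Proof.
move=> ta tb tc td mN dN.
have N0 y : 0 <= N y by have := le_trans (dirac_norm_ge0 _ _ _ _ _) (dN y); lra.
have k0 y : 0 <= (sqdist x y)^-1 by rewrite invr_ge0 sqdist_ge0.
have mk : measurable_fun setT ((fun y => (sqdist x y)^-1) : M3 -> R).
  apply: measurable_fun_inv_ge0; first exact: sqdist_ge0.
  exact: continuous_measurable3 (@continuous_sqdist _ x).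
have le2 : ((4 / 3)%:E * \int[mu3]_y ((sqdist x y)^-1 * dirac_norm a b c d y)%:E <=
    (8 / 3)%:E * \int[mu3]_y ((sqdist x y)^-1 * N y)%:E)%E.
  rewrite [in leRHS](_ : 8 / 3 = 4 / 3 * 2 :> R); last by field.
  rewrite [(4 / 3 * 2)%:E]EFinM -muleA lee_pmul2l// -ge0_integralZl//.
  - apply: ge0_le_integral => //.
    + by move=> y _; rewrite lee_fin mulr_ge0// dirac_norm_ge0.
    + apply/measurable_EFinP; apply: measurable_funM => //.
      exact: continuous_measurable3 (continuous_dirac_norm ta tb tc td).
    + apply/measurable_EFinP; apply: measurable_funM => //.
      exact: measurable_funM.
    + by move=> y _; rewrite -EFinM lee_fin mulrCA ler_wpM2l.
  - by apply/measurable_EFinP; exact: measurable_funM.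
  - by move=> y _; rewrite lee_fin mulr_ge0.
have [ax|ax] := leP 0 (a x).
  by rewrite ger0_norm//; apply: le_trans le2; exact: test_fun_le ta tb tc td x.
rewrite ltr0_norm//; apply: le_trans le2.
have -> : (\int[mu3]_y ((sqdist x y)^-1 * dirac_norm a b c d y)%:E =
    \int[mu3]_y ((sqdist x y)^-1 * dirac_norm (- a) (- b) (- c) (- d) y)%:E)%E.
  by apply: eq_integral => y _; rewrite (dirac_normN _ ta tb tc td).
exact: test_fun_le (test_funN ta) (test_funN tb) (test_funN tc) (test_funN td) x.
Qed.

End Abs.

(** * The Dirac operator in real coordinates *)

Section Sigma.
Variable R : realType.
Local Notation R3 := (R * R * R)%type.
Local Notation Re := complex.Re.
Local Notation Im := complex.Im.

Lemma normcE (z : R[i]) : Normc.normc z = Num.sqrt (Re z ^+ 2 + Im z ^+ 2).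
Proof. by case: z. Qed.

Lemma normc_ge_Re (z : R[i]) : `|Re z| <= Normc.normc z.
Proof.
by rewrite normcE -sqrtr_sqr ler_wsqrtr// lerDl sqr_ge0.
Qed.

Lemma normc_ge_Im (z : R[i]) : `|Im z| <= Normc.normc z.
Proof.
by rewrite normcE -sqrtr_sqr ler_wsqrtr// lerDr sqr_ge0.
Qed.

Lemma normc_le_ReIm (z : R[i]) : Normc.normc z <= `|Re z| + `|Im z|.
Proof.
rewrite normcE -[leRHS]ger0_norm ?addr_ge0// -sqrtr_sqr ler_wsqrtr//.
rewrite sqrrD !real_normK ?num_real//.
have : 0 <= `|Re z| * `|Im z| by rewrite mulr_ge0.
by lra.
Qed.

Lemma mx2_mul0 (p q r s : R[i]) (v : 'cV[R[i]]_2) :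
  (mx2 p q r s *m v) 0 0 = p * v 0 0 + q * v 1 0.
Proof. by rewrite mxE big_ord_recl big_ord1 !mxE (_ : lift ord0 ord0 = 1) //; exact: val_inj. Qed.

Lemma mx2_mul1 (p q r s : R[i]) (v : 'cV[R[i]]_2) :
  (mx2 p q r s *m v) 1 0 = r * v 0 0 + s * v 1 0.
Proof. by rewrite mxE big_ord_recl big_ord1 !mxE (_ : lift ord0 ord0 = 1) //; exact: val_inj. Qed.

Lemma sum_ord3 (V : nmodType) (F : 'I_3 -> V) : \sum_(j < 3) F j = F 0 + F 1 + F 2.
Proof.
by rewrite !big_ord_recl big_ord0 addr0 addrA; congr (F _ + F _ + F _); exact: val_inj.
Qed.

Lemma pauli_sum0 (Q : 'I_3 -> 'cV[R[i]]_2) :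
  (- 'i%C *: \sum_(j < 3) (pauli j *m Q j)) 0 0 =
  - 'i%C * (Q 0 1 0 - 'i%C * Q 1 1 0 + Q 2 0 0).
Proof.
rewrite mxE sum_ord3 2!mxE; congr (_ * _).
rewrite /pauli !(tnth_nth 0) /= !mx2_mul0.
by rewrite !(mul0r, mul1r, add0r, addr0, mulNr).
Qed.

Lemma pauli_sum1 (Q : 'I_3 -> 'cV[R[i]]_2) :
  (- 'i%C *: \sum_(j < 3) (pauli j *m Q j)) 1 0 =
  - 'i%C * (Q 0 0 0 + 'i%C * Q 1 0 0 - Q 2 1 0).
Proof.
rewrite mxE sum_ord3 2!mxE; congr (_ * _).
rewrite /pauli !(tnth_nth 0) /= !mx2_mul1.
by rewrite !(mul0r, mul1r, add0r, addr0, mulNr).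
Qed.

(** With the derivatives replaced by arbitrary entries, the complex arithmetic is a plain ring
    identity. *)
Lemma pauli_col0 (re im : 'I_3 -> 'I_2 -> R) :
  (- 'i%C *: \sum_(j < 3) (pauli j *m \col_(k < 2) (re j k +i* im j k)%C)) 0 0 =
  ((im 2 0 + im 0 1 - re 1 1) +i* - (re 2 0 + re 0 1 + im 1 1))%C.
Proof.
by rewrite (pauli_sum0 (fun j => \col_k (re j k +i* im j k)%C)) !mxE; simpc; congr (_ +i* _)%C; ring.
Qed.

Lemma pauli_col1 (re im : 'I_3 -> 'I_2 -> R) :
  (- 'i%C *: \sum_(j < 3) (pauli j *m \col_(k < 2) (re j k +i* im j k)%C)) 1 0 =
  ((im 0 0 + re 1 0 - im 2 1) +i* - (re 0 0 - im 1 0 - re 2 1))%C.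
Proof.
by rewrite (pauli_sum1 (fun j => \col_k (re j k +i* im j k)%C)) !mxE; simpc; congr (_ +i* _)%C; ring.
Qed.

Section Components.
Variable f : R3 -> 'cV[R[i]]_2.
Local Notation a := (fun y => Re (f y 0 0)).
Local Notation b := (fun y => Im (f y 0 0)).
Local Notation c := (fun y => Re (f y 1 0)).
Local Notation d := (fun y => Im (f y 1 0)).

(** The imaginary part is minus [dirac1]; the real part is the one component that does not enter the
    bound on [a]. *)
Lemma sigma_pE0 y : sigma_p f y 0 0 =
  ((partial 2 b y + partial 0 d y - partial 1 c y) +i* - (partial 2 a y + partial 0 c y + partial 1 d y))%C.
Proof.
exact: (pauli_col0 (fun j k => partial j (fun z => Re (f z k 0)) y) (fun j k => partial j (fun z => Im (f z k 0)) y)).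
Qed.

Lemma sigma_pE1 y : sigma_p f y 1 0 =
  ((partial 0 b y + partial 1 a y - partial 2 d y) +i* - (partial 0 a y - partial 1 b y - partial 2 c y))%C.
Proof.
exact: (pauli_col1 (fun j k => partial j (fun z => Re (f z k 0)) y) (fun j k => partial j (fun z => Im (f z k 0)) y)).
Qed.
End Components.
End Sigma.

(** * Real test functions from a smooth compactly supported spinor *)

Section Spinor.
Variable R : realType.
Local Notation R3 := (R * R * R)%type.
Local Notation Re := complex.Re.
Local Notation Im := complex.Im.

Lemma test_fun_widen (L L' : R) (u : R3 -> R) : L <= L' -> test_fun L u -> test_fun L' u.
Proof.
move=> LL [h1 h2 h3 h4]; split=> // x nx; apply: h4 => /cubeE[q1 q2 q3]; apply: nx.
by apply/cubeE; split; exact: lt_le_trans LL.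
Qed.

Lemma smooth_test_fun (u : R3 -> R) (A : set R3) : smooth u -> compact (closure A) ->
  (forall x, u x != 0 -> A x) -> exists L, test_fun L u.
Proof.
move=> su /compact_bounded[M [_ hM]] uA.
pose M' := M + 1.
have u0 x : M' < `|x| -> u x = 0.
  move=> Mx; apply/eqP; apply: contraTT Mx => /uA Ax; rewrite -leNgt.
  by apply: (hM M'); [rewrite ltrDl|exact: subset_closure].
(* The extra 1 places the complement of the open cube inside the open set [M' < |y|]; there u
   vanishes near each point, hence so do its partial derivatives. *)
exists (M' + 1); split.
- by have [] := su [::].
- by move=> j; have [] := su [:: j].
- by have [_] := su [::].
move=> x; rewrite cube_normE => /negP; rewrite -leNgt => Mx.
have Mx' : M' < `|x| by rewrite (lt_le_trans _ Mx)// ltrDl.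
split=> [|j]; first exact: u0.
rewrite /partial (_ : 0 = 'D_(basis3 j) (cst 0 : R3 -> R) x); last by rewrite derive_cst.
apply: near_eq_derive.
have : nbhs x [set y : R3 | M' < `|y|].
  apply: open_nbhs_nbhs; split => //.
  apply: (@open_comp _ _ (fun y : R3 => `|y|) [set t | M' < t]); last exact: open_gt.
  by move=> y _; exact: norm_continuous.
by apply: filterS => y /= /u0.
Qed.

Variable f : R3 -> 'cV[R[i]]_2.
Hypothesis f0 : C0infty f.

Lemma C0infty_test_fun : exists L, forall k : 'I_2,
  test_fun L (fun y => Re (f y k 0)) /\ test_fun L (fun y => Im (f y k 0)).
Proof.
have h (k : 'I_2) : exists L, test_fun L (fun y => Re (f y k 0)) /\ test_fun L (fun y => Im (f y k 0)).
  have [[sr si] cs] := f0 k.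
  have [L1 h1] : exists L, test_fun L (fun y => Re (f y k 0)).
    by apply: smooth_test_fun sr cs _ => x /=; apply: contra_neq => ->.
  have [L2 h2] : exists L, test_fun L (fun y => Im (f y k 0)).
    by apply: smooth_test_fun si cs _ => x /=; apply: contra_neq => ->.
  by exists (Num.max L1 L2); split; [apply: test_fun_widen h1|apply: test_fun_widen h2]; rewrite le_max lexx ?orbT.
have [[L1 [p1 q1]] [L2 [p2 q2]]] := (h 0, h 1).
exists (Num.max L1 L2) => k.
have [->|->] : k = 0 \/ k = 1 by case: k => -[|[|//]] ?; [left|right]; exact: val_inj.
- by split; [apply: test_fun_widen p1|apply: test_fun_widen q1]; rewrite le_max lexx.
- by split; [apply: test_fun_widen p2|apply: test_fun_widen q2]; rewrite le_max lexx orbT.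
Qed.

End Spinor.

(** * The pointwise bound for spinors *)

Section SpinorBound.
Variable R : realType.
Local Notation R3 := (R * R * R)%type.
Local Notation M1 := (measurableTypeR R).
Local Notation M3 := (M1 * M1 * M1)%type.
Local Notation Re := complex.Re.
Local Notation Im := complex.Im.

(** [n0] and [n1] stand for the moduli of the two components of [sigma_p f]; each dominates a real
    and an imaginary part. The bounds on [a] and [b] use [n0] once and [n1] twice, those on [c] and
    [d] the reverse, so 2 (n0 + n1) covers all four, and 32/3 is four times 8/3. *)
Lemma test_fun4_le (L : R) (a b c d n0 n1 : R3 -> R) x :
  test_fun L a -> test_fun L b -> test_fun L c -> test_fun L d ->
  measurable_fun setT ((fun y => n0 y + n1 y) : M3 -> R) ->
  (forall y, `|partial 2 a y + partial 0 c y + partial 1 d y| <= n0 y) ->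
  (forall y, `|partial 2 b y + partial 0 d y - partial 1 c y| <= n0 y) ->
  (forall y, `|partial 0 a y - partial 1 b y - partial 2 c y| <= n1 y) ->
  (forall y, `|partial 0 b y + partial 1 a y - partial 2 d y| <= n1 y) ->
  ((`|a x| + `|b x| + `|c x| + `|d x|)%:E <=
    (32 / 3)%:E * \int[mu3]_y ((sqdist x y)^-1 * (n0 y + n1 y))%:E)%E.
Proof.
move=> ta tb tc td mn hP hT hQ hS.
have [tna tnb tnc] := And3 (test_funN ta) (test_funN tb) (test_funN tc).
have tnd := test_funN td.
have hx (p q r s t : R) : `|p| <= s -> `|q| <= t -> `|r| <= t -> `|p| + `|q| + `|r| <= 2 * (s + t).
  by have := normr_ge0 p; lra.
have hy (p q r s t : R) : `|p| <= s -> `|q| <= t -> `|r| <= s -> `|p| + `|q| + `|r| <= 2 * (s + t).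
  by have := normr_ge0 q; lra.
have Ha := @test_fun_abs_le _ L a b c d _ x ta tb tc td mn.
have Hb := @test_fun_abs_le _ L b (- a) d (- c) _ x tb tna td tnc mn.
have Hc := @test_fun_abs_le _ L c (- d) (- a) b _ x tc tnd tna tb mn.
have Hd := @test_fun_abs_le _ L d c (- b) (- a) _ x td tc tnb tna mn.
have {}Ha : (`|a x|%:E <= (8 / 3)%:E * \int[mu3]_y ((sqdist x y)^-1 * (n0 y + n1 y))%:E)%E.
  apply: Ha => y; rewrite /dirac_norm /dirac1 /dirac2 /dirac3.
  move: (hP y) (hQ y) (hS y); move: (partial 2 a y + _ + _) (partial 0 a y - _ - _) => P Q.
  by move: (partial 0 b y) (partial 1 a y) (partial 2 d y) => ? ? ?; rewrite [X in `|X - _| <= _]addrC => *; exact: hx.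
have {}Hb : (`|b x|%:E <= (8 / 3)%:E * \int[mu3]_y ((sqdist x y)^-1 * (n0 y + n1 y))%:E)%E.
  apply: Hb => y; rewrite /dirac_norm /dirac1 /dirac2 /dirac3 !(partialN _ _ ta) !(partialN _ _ tc).
  move: (hT y) (hS y) (hQ y).
  move: (partial 2 b y) (partial 0 d y) (partial 1 c y) (partial 0 b y) (partial 1 a y) (partial 2 d y)
    (partial 0 a y) (partial 1 b y) (partial 2 c y) => p1 p2 p3 p4 p5 p6 p7 p8 p9 h1 h2 h3.
  rewrite !opprK (_ : p8 - p7 + p9 = - (p7 - p8 - p9)) ?normrN; last by ring.
  exact: hx.
have {}Hc : (`|c x|%:E <= (8 / 3)%:E * \int[mu3]_y ((sqdist x y)^-1 * (n0 y + n1 y))%:E)%E.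
  apply: Hc => y; rewrite /dirac_norm /dirac1 /dirac2 /dirac3 !(partialN _ _ ta) !(partialN _ _ td).
  move: (hQ y) (hP y) (hT y).
  move: (partial 2 b y) (partial 0 d y) (partial 1 c y) (partial 0 a y) (partial 1 b y) (partial 2 c y)
    (partial 2 a y) (partial 0 c y) (partial 1 d y) => p1 p2 p3 p4 p5 p6 p7 p8 p9 h1 h2 h3.
  rewrite (_ : p6 - p4 + p5 = - (p4 - p5 - p6)) ?normrN; last by ring.
  rewrite (_ : p8 - - p9 - - p7 = p7 + p8 + p9); last by ring.
  rewrite (_ : p3 - p2 - p1 = - (p1 + p2 - p3)) ?normrN; last by ring.
  by rewrite [n0 y + _]addrC; exact: hx.
have {}Hd : (`|d x|%:E <= (8 / 3)%:E * \int[mu3]_y ((sqdist x y)^-1 * (n0 y + n1 y))%:E)%E.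
  apply: Hd => y; rewrite /dirac_norm /dirac1 /dirac2 /dirac3 !(partialN _ _ ta) !(partialN _ _ tb).
  move: (hS y) (hT y) (hP y).
  move: (partial 2 b y) (partial 0 d y) (partial 1 c y) (partial 0 b y) (partial 1 a y) (partial 2 d y)
    (partial 2 a y) (partial 0 c y) (partial 1 d y) => p1 p2 p3 p4 p5 p6 p7 p8 p9 h1 h2 h3.
  rewrite (_ : p6 - p4 - p5 = - (p4 + p5 - p6)) ?normrN; last by ring.
  rewrite (_ : p2 - p3 - - p1 = p1 + p2 - p3); last by ring.
  rewrite (_ : p9 + p8 - - p7 = p7 + p8 + p9); last by ring.
  by rewrite [n0 y + _]addrC; exact: hx.
move: Ha Hb Hc Hd; set J := integral _ _ _ => Ha Hb Hc Hd.
rewrite (_ : 32 / 3 = 8 / 3 + 8 / 3 + 8 / 3 + 8 / 3 :> R); last by field.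
by rewrite !EFinD !ge0_muleDl ?lee_fin//; do 3 apply: leeD => //.
Qed.

Variable f : R3 -> 'cV[R[i]]_2.
Hypothesis f0 : C0infty f.

Lemma normC2E (v : 'cV[R[i]]_2) : normC2 v = Normc.normc (v 0 0) + Normc.normc (v 1 0).
Proof. by rewrite /normC2 big_ord_recl big_ord1; congr (_ + Normc.normc (v _ _)); exact: val_inj. Qed.

Lemma normC2_ge0 (v : 'cV[R[i]]_2) : 0 <= normC2 v.
Proof. by rewrite normC2E !normcE addr_ge0 ?sqrtr_ge0. Qed.

Lemma measurable_normc (p q : R3 -> R) : continuous p -> continuous q ->
  measurable_fun setT ((fun y => Normc.normc (p y +i* q y)%C) : M3 -> R).
Proof.
move=> cp cq; apply: continuous_measurable3 => y.
apply: (@continuous_comp _ _ _ (fun y => p y ^+ 2 + q y ^+ 2) Num.sqrt); last exact: sqrt_continuous.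
have c2 (g : R3 -> R) : continuous g -> continuous (fun y => g y ^+ 2).
  by move=> cg z; apply: (@continuous_comp _ _ _ g (fun t : R => t ^+ 2)); [exact: cg|exact: exprn_continuous].
exact: (@continuousD _ _ _ (fun y => p y ^+ 2) (fun y => q y ^+ 2) y (c2 _ cp y) (c2 _ cq y)).
Qed.

Lemma measurable_sigma_p : measurable_fun setT ((fun y => normC2 (sigma_p f y)) : M3 -> R).
Proof.
have [L h] := C0infty_test_fun f0.
have [[[_ pa _ _] [_ pb _ _]] [[_ pc _ _] [_ pd _ _]]] := (h 0, h 1).
have cA (u v : R3 -> R) : continuous u -> continuous v -> continuous (fun y : R3 => u y + v y : R).
  by move=> cf cg y; apply: continuousD; [exact: cf|exact: cg].
have cN (u : R3 -> R) : continuous u -> continuous (fun y : R3 => - u y : R).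
  by move=> cf y; apply: continuousN; exact: cf.
rewrite (_ : (fun y => _) = (fun y => Normc.normc (sigma_p f y 0 0) + Normc.normc (sigma_p f y 1 0))); last first.
  by apply/funext => y; rewrite normC2E.
apply: measurable_funD.
  have := measurable_normc (cA _ _ (cA _ _ (pb 2) (pd 0)) (cN _ (pc 1))) (cN _ (cA _ _ (cA _ _ (pa 2) (pc 0)) (pd 1))).
  by congr (measurable_fun _ _); apply/funext => y; rewrite sigma_pE0.
have := measurable_normc (cA _ _ (cA _ _ (pb 0) (pa 1)) (cN _ (pd 2))) (cN _ (cA _ _ (cA _ _ (pa 0) (cN _ (pb 1))) (cN _ (pc 2)))).
by congr (measurable_fun _ _); apply/funext => y; rewrite sigma_pE1.
Qed.

Lemma spinor_le x : ((normC2 (f x))%:E <=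
  (32 / 3)%:E * \int[mu3]_y ((sqdist x y)^-1 * normC2 (sigma_p f y))%:E)%E.
Proof.
have [L h] := C0infty_test_fun f0; have [[ta tb] [tc td]] := (h 0, h 1).
have mN := measurable_sigma_p.
have -> : (\int[mu3]_y ((sqdist x y)^-1 * normC2 (sigma_p f y))%:E =
   \int[mu3]_y ((sqdist x y)^-1 * (Normc.normc (sigma_p f y 0 0) + Normc.normc (sigma_p f y 1 0)))%:E)%E.
  by apply: eq_integral => y _; rewrite normC2E.
apply: le_trans (test_fun4_le x ta tb tc td _ _ _ _ _).
- by rewrite lee_fin normC2E -addrA lerD// normc_le_ReIm.
- by move: mN; congr (measurable_fun _ _); apply/funext => y; rewrite normC2E.
- by move=> y; have := normc_ge_Im (sigma_p f y 0 0); rewrite {1}sigma_pE0 normrN.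
- by move=> y; have := normc_ge_Re (sigma_p f y 0 0); rewrite {1}sigma_pE0.
- by move=> y; have := normc_ge_Im (sigma_p f y 1 0); rewrite {1}sigma_pE1 normrN.
- by move=> y; have := normc_ge_Re (sigma_p f y 1 0); rewrite {1}sigma_pE1.
Qed.
End SpinorBound.

(** * The inverse-square kernel on a set of given measure *)

Section Riesz.
Variable R : realType.
Local Notation R3 := (R * R * R)%type.
Local Notation M1 := (measurableTypeR R).
Local Notation M3 := (M1 * M1 * M1)%type.
Implicit Types (x y : R3).

Lemma sqdistC x y : sqdist x y = sqdist y x.
Proof. by rewrite /sqdist -(sqrrN (y.1.1 - _)) -(sqrrN (y.1.2 - _)) -(sqrrN (y.2 - _)) !opprB. Qed.

Lemma sqdist_inv_le x y r : 0 < r -> ~ cube y r x -> (sqdist x y)^-1 <= (r ^+ 2)^-1.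
Proof.
move=> r0 nx; have r2 : 0 < r ^+ 2 by rewrite exprn_gt0.
suff h : r ^+ 2 <= sqdist x y by rewrite lef_pV2 ?posrE// (lt_le_trans r2).
rewrite leNgt; apply/negP => h; apply: nx; rewrite sqdistC in h; apply/cubeE.
have hs (t : R) : t ^+ 2 < r ^+ 2 -> `|t| < r.
  by move=> te; rewrite -(ltr_pXn2r (n := 2)) ?nnegrE ?normr_ge0 ?(ltW r0)// real_normK ?num_real.
move: h; rewrite /sqdist.
have := (sqr_ge0 (x.1.1 - y.1.1), sqr_ge0 (x.1.2 - y.1.2), sqr_ge0 (x.2 - y.2)).
by move=> [[? ?] ?] ?; split; apply: hs; lra.
Qed.

(** Some r / 2^N is at most s because 2^k > k; descending from such an N, the last exponent that
    still works is n + 1. *)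
Lemma dyadic_shell (r s : R) : 0 < s -> s < r -> exists n, r / 2 ^+ n.+1 <= s < r / 2 ^+ n.
Proof.
move=> s0 sr.
have [N hN] : exists N, r / 2 ^+ N <= s.
  exists (Num.truncn (r / s)).+1; rewrite ler_pdivrMr ?exprn_gt0// mulrC -ler_pdivrMr//.
  apply: le_trans (ltW (truncnS_gt _)) _.
  by rewrite -natrX ler_nat ltnW// ltn_expl.
elim: N hN => [|N IH] hN; first by move: hN; rewrite expr0 divr1 leNgt sr.
by have [/IH//|h] := leP (r / 2 ^+ N) s; exists N; rewrite hN.
Qed.

(** The bound (2^(n+1) / rho)^2, valid on the n-th shell, is spread over the whole cube that
    contains it, whose measure is explicit; the overlap costs only a constant. *)
Definition shells (y : R3) (rho : R) (n : nat) (x : R3) : \bar R :=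
  ((4 ^+ n.+1 / rho ^+ 2) * \1_(cube y (rho / 2 ^+ n)) x)%:E.

Lemma shells_ge0 y rho n x : (0 <= shells y rho n x)%E.
Proof. by rewrite lee_fin mulr_ge0// divr_ge0 ?sqr_ge0 ?exprn_ge0. Qed.

Lemma sqdist_inv_shells y rho x : 0 < rho ->
  (((sqdist x y)^-1)%:E <= ((rho ^+ 2)^-1)%:E + \sum_(n <oo) shells y rho n x)%E.
Proof.
move=> rho0.
have S0 : (0 <= \sum_(n <oo) shells y rho n x)%E by apply: nneseries_ge0 => *; exact: shells_ge0.
have [xr|xr] := pselect (cube y rho x); last first.
  by rewrite (le_trans _ (leeDl _ S0))// lee_fin sqdist_inv_le.
(* No shell contains y itself, but the left side is 0 there because 0^-1 = 0. *)
have [xy|xy] := eqVneq x y.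
  rewrite {1}xy /sqdist !subrr !expr0n /= !addr0 invr0.
  by apply: adde_ge0 => //; rewrite lee_fin invr_ge0 sqr_ge0.
pose s := `|x - y|.
have cs t : cube y t x <-> s < t by rewrite /cube -ball_normE /= distrC.
have s0 : 0 < s by rewrite normr_gt0 subr_eq0.
have [n /andP[n1 n2]] := dyadic_shell s0 ((cs _).1 xr).
apply: le_trans (leeDr _ _); last by rewrite lee_fin invr_ge0 sqr_ge0.
apply: (@le_trans _ _ (shells y rho n x)).
  rewrite /shells indicE mem_set ?mulr1; last exact/cs.
  have r1 : 0 < rho / 2 ^+ n.+1 by rewrite divr_gt0// exprn_gt0.
  rewrite lee_fin (le_trans (sqdist_inv_le r1 _))//; first by move/cs; rewrite ltNge n1.
  rewrite expr_div_n invf_div -exprM mulnC exprM.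
  by rewrite (_ : 2 ^+ 2 = 4 :> R)//; ring.
apply: le_trans (nneseries_lim_ge n.+1 _); last by move=> *; exact: shells_ge0.
rewrite big_nat_recr//= leeDr// sume_ge0// => *; exact: shells_ge0.
Qed.

(** The scale rho = mu(E)^(1/3) balances the two parts: the constant gives rho^-2 rho^3 = rho, the
    n-th cube at most (4^(n+1) / rho^2) 8 (rho / 2^n)^3 = 64 rho / 2^(n+1), and these sum to 64
    rho. *)
Lemma integral_sqdist_inv_le y (E : set M3) rho : measurable E -> 0 < rho ->
  mu3 E = (rho ^+ 3)%:E ->
  (\int[mu3]_(x in E) ((sqdist x y)^-1)%:E <= (65 * rho)%:E)%E.
Proof.
move=> mE rho0 Erho.
have mS n : measurable_fun E (shells y rho n : M3 -> \bar R).
  apply/measurable_EFinP; apply: measurable_funM => //.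
  by apply: measurable_indic; exact: measurable_cube.
apply: (@le_trans _ _ (\int[mu3]_(x in E) (((rho ^+ 2)^-1)%:E + \sum_(n <oo) shells y rho n x))%E).
  apply: ge0_le_integral => //.
  - by move=> x _; rewrite lee_fin invr_ge0 sqdist_ge0.
  - apply: measurable_funTS; apply/measurable_EFinP.
    apply: measurable_fun_inv_ge0; first by move=> x; exact: sqdist_ge0.
    rewrite (_ : (fun x => _) = sqdist y); first exact: continuous_measurable3 (@continuous_sqdist _ y).
    by apply/funext => x; rewrite sqdistC.
  - apply: emeasurable_funD => //.
    by apply: ge0_emeasurable_sum => // n x _ _; exact: shells_ge0.
  - by move=> x _; exact: sqdist_inv_shells.
rewrite ge0_integralD//; last 3 first.
- by move=> x _; rewrite lee_fin invr_ge0 sqr_ge0.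
- by move=> x _; apply: nneseries_ge0 => *; exact: shells_ge0.
- by apply: ge0_emeasurable_sum => // n x _ _; exact: shells_ge0.
rewrite integral_cst// [X in (_ * X + _)%E]Erho -EFinM.
have -> : (rho ^+ 2)^-1 * rho ^+ 3 = rho by field; rewrite lt0r_neq0.
rewrite (_ : 65 * rho = rho + 64 * rho); last by ring.
rewrite EFinD leeD2l// integral_nneseries//; last by move=> *; exact: shells_ge0.
have H := @cvg_geometric_eseries_half R (64 * rho) 0.
rewrite expr0 divr1 in H.
have <- : (\sum_(k <oo) ((64 * rho) / (2 ^ (k + 1))%:R)%:E = (64 * rho)%:E)%E.
  exact: (cvg_lim _ H).
apply: lee_nneseries => [n _ _|n _].
  by apply: integral_ge0 => x _; exact: shells_ge0.
set Q : set M3 := cube y (rho / 2 ^+ n); have mQ : measurable Q := measurable_cube _ _.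
have c0 : 0 <= 4 ^+ n.+1 / rho ^+ 2 by rewrite divr_ge0 ?sqr_ge0 ?exprn_ge0.
have r0 : 0 <= rho / 2 ^+ n by rewrite divr_ge0 ?exprn_ge0// ltW.
have -> : (\int[mu3]_(x in E) shells y rho n x =
    (4 ^+ n.+1 / rho ^+ 2)%:E * \int[mu3]_(x in E) (\1_Q x)%:E)%E.
  rewrite -ge0_integralZl//.
  by apply/measurable_EFinP; exact: measurable_indic.
rewrite (integral_indic (@mu3 R) mE mQ).
have QE : (mu3 (Q `&` E) <= (8 * (rho / 2 ^+ n) ^+ 3)%:E)%E.
  rewrite -(mu3_cube y r0); apply: (le_measure (@mu3 R)).
  - by apply/mem_set; exact: measurableI.
  - exact/mem_set.
  - exact: subIsetl.
apply: (le_trans (lee_wpmul2l _ QE)); rewrite ?lee_fin// natrX.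
have p0 : 0 < 2 ^+ n :> R by rewrite exprn_gt0.
rewrite exprS addn1 [2 ^+ n.+1]exprS (_ : 4 ^+ n = 2 ^+ n * 2 ^+ n :> R); last first.
  by rewrite -exprMn; congr (_ ^+ _); rewrite -natrM.
rewrite le_eqVlt; apply/orP; left; apply/eqP.
by field; rewrite !lt0r_neq0.
Qed.
End Riesz.

(** * The weak-type estimate on superlevel sets *)

Section WeakType.
Variable R : realType.
Local Notation R3 := (R * R * R)%type.
Local Notation M1 := (measurableTypeR R).
Local Notation M3 := (M1 * M1 * M1)%type.

Lemma measurable_sqdist : measurable_fun setT ((fun p => sqdist p.1 p.2) : M3 * M3 -> R).
Proof.
have m1 : measurable_fun setT (fst : M3 * M3 -> M3) := measurable_fst.
have m2 : measurable_fun setT (snd : M3 * M3 -> M3) := measurable_snd.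
have n1 : measurable_fun setT (fst : M3 -> M1 * M1) := measurable_fst.
have n2 : measurable_fun setT (snd : M3 -> R) := measurable_snd.
have l1 : measurable_fun setT (fst : M1 * M1 -> R) := measurable_fst.
have l2 : measurable_fun setT (snd : M1 * M1 -> R) := measurable_snd.
rewrite /sqdist; apply: measurable_funD; first apply: measurable_funD;
  apply: measurable_funX; apply: measurable_funB.
- exact: (measurableT_comp l1 (measurableT_comp n1 m2)).
- exact: (measurableT_comp l1 (measurableT_comp n1 m1)).
- exact: (measurableT_comp l2 (measurableT_comp n1 m2)).
- exact: (measurableT_comp l2 (measurableT_comp n1 m1)).
- exact: (measurableT_comp n2 m2).
- exact: (measurableT_comp n2 m1).
Qed.

(** Tonelli moves the integration over E onto the kernel, whose integral is bounded uniformly in y.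
    The indicator of E is put into [F] so that both integrals run over the whole space. *)
Lemma integral_riesz_le (N : R3 -> R) (E : set M3) rho : measurable_fun setT (N : M3 -> R) ->
  (forall y, 0 <= N y) -> measurable E -> 0 < rho -> mu3 E = (rho ^+ 3)%:E ->
  (\int[mu3]_(x in E) \int[mu3]_y ((sqdist x y)^-1 * N y)%:E <=
   (65 * rho)%:E * \int[mu3]_y (N y)%:E)%E.
Proof.
move=> mN N0 mE rho0 Erho.
pose k x y : R := (sqdist x y)^-1.
have k0 x y : 0 <= k x y by rewrite invr_ge0 sqdist_ge0.
pose F (p : M3 * M3) : \bar R := (\1_E p.1 * (k p.1 p.2 * N p.2))%:E.
have mF : measurable_fun setT F.
  apply/measurable_EFinP; apply: measurable_funM.
    by apply: (measurableT_comp (f := \1_E : M3 -> R)); [exact: measurable_indic|exact: measurable_fst].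
  apply: measurable_funM.
    by apply: measurable_fun_inv_ge0; [move=> p; exact: sqdist_ge0|exact: measurable_sqdist].
  by apply: (measurableT_comp (f := N : M3 -> R)) => //; exact: measurable_snd.
have F0 p : (0 <= F p)%E by rewrite lee_fin !mulr_ge0.
have := @fubini_tonelli _ _ M3 M3 R (@mu3 R) (@mu3 R) F mF F0.
have mk y : measurable_fun setT ((fun x => k x y) : M3 -> R).
  apply: measurable_fun_inv_ge0; first by move=> x; exact: sqdist_ge0.
  rewrite (_ : (fun x => _) = sqdist y); first exact: continuous_measurable3 (@continuous_sqdist _ y).
  by apply/funext => x; rewrite sqdistC.
have -> : (\int[mu3]_x \int[mu3]_y F (x, y) = \int[mu3]_(x in E) \int[mu3]_y (k x y * N y)%:E)%E.
  rewrite [RHS]integral_mkcond; apply: eq_integral => x _; rewrite patchE /F /=.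
  case: ifPn => xE; last first.
    by rewrite integral0_eq// => y _; rewrite indicE (negbTE xE) mul0r.
  by apply: eq_integral => y _; rewrite indicE xE mul1r.
move=> ->.
rewrite -ge0_integralZl//; last first.
  by rewrite lee_fin mulr_ge0// ltW.
  by move=> y _; rewrite lee_fin.
  exact/measurable_EFinP.
apply: ge0_le_integral => //.
- by move=> y _; exact: integral_ge0.
- exact: measurable_fun_fubini_tonelli_G.
- by apply/measurable_EFinP; exact: measurable_funM.
move=> y _.
have -> : (\int[mu3]_x F (x, y) = (N y)%:E * \int[mu3]_(x in E) (k x y)%:E)%E.
  rewrite -ge0_integralZl//; last first.
    by rewrite lee_fin.
    by move=> x _; rewrite lee_fin.
    by apply: measurable_funTS; exact/measurable_EFinP.
  rewrite [RHS]integral_mkcond; apply: eq_integral => x _; rewrite patchE /F /=.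
  by rewrite indicE; case: ifPn => xE; rewrite ?mul0r// mul1r mulrC.
by rewrite muleC lee_wpmul2r ?lee_fin// integral_sqdist_inv_le.
Qed.

Variable f : R3 -> 'cV[R[i]]_2.
Hypothesis f0 : C0infty f.

Lemma measurable_normC2 : measurable_fun setT ((fun x => normC2 (f x)) : M3 -> R).
Proof.
have [L h] := C0infty_test_fun f0.
have [[[ca _ _ _] [cb _ _ _]] [[cc _ _ _] [cd _ _ _]]] := (h 0, h 1).
rewrite (_ : (fun x => _) = (fun x => Normc.normc (f x 0 0) + Normc.normc (f x 1 0))); last first.
  by apply/funext => x; rewrite normC2E.
apply: measurable_funD.
  have := measurable_normc ca cb.
  by congr (measurable_fun _ _); apply/funext => x; case: (f x 0 0).
have := measurable_normc cc cd.
by congr (measurable_fun _ _); apply/funext => x; case: (f x 1 0).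
Qed.

(** Gives superlevel sets finite measure, so that the factor mu(E)^(1/3) can be cancelled. *)
Lemma superlevel_bounded t : 0 <= t -> exists L, [set x | t < normC2 (f x)] `<=` cube 0 L.
Proof.
move=> t0; have [L h] := C0infty_test_fun f0; exists L => x /= tx.
apply: contrapT => nx; move: tx; rewrite normC2E !normcE.
have [[[_ _ _ ha] [_ _ _ hb]] [[_ _ _ hc] [_ _ _ hd]]] := (h 0, h 1).
by rewrite (ha _ nx).1 (hb _ nx).1 (hc _ nx).1 (hd _ nx).1 expr0n /= addr0 sqrtr0 addr0 ltNge t0.
Qed.

Local Notation I := (\int[mu3]_y (normC2 (sigma_p f y))%:E)%E.

Lemma superlevel_le t : 0 < t ->
  ((t `^ (3 / 2))%:E * mu3 [set x | (t < normC2 (f x))%R] <= (700%:E * I) `^ (3 / 2))%E.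
Proof.
move=> t0; set E : set M3 := [set x | t < normC2 (f x)].
have mE : measurable E.
  have := measurable_normC2 measurableT (measurable_itv `]t, +oo[).
  by rewrite setTI; congr measurable; apply/seteqP; split=> x /=; rewrite in_itv/= andbT.
have I0 : (0 <= I)%E by apply: integral_ge0 => y _; rewrite lee_fin normC2_ge0.
have [L EL] := superlevel_bounded (ltW t0).
have Efin : (mu3 E < +oo)%E.
  have EL' : E `<=` cube 0 `|L|.
    move=> x /EL /cubeE[h1 h2 h3]; apply/cubeE.
    by split; apply: lt_le_trans (ler_norm L).
  have : (mu3 E <= mu3 (cube 0%R `|L|%R))%E.
    by apply: (le_measure (@mu3 R)) => //; apply/mem_set => //; exact: measurable_cube.
  by move=> /le_lt_trans; apply; rewrite [ltLHS]mu3_cube// ltry.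
have E0 : (0 <= mu3 E)%E by exact: measure_ge0.
pose m := fine (mu3 E).
have Em : mu3 E = m%:E by rewrite fineK// ge0_fin_numE.
have m0 : 0 <= m by exact: fine_ge0.
(* A null E is settled apart, since the cancellation below divides by rho > 0. *)
move: m0; rewrite le_eqVlt => /predU1P[m0|m0].
  by rewrite Em -m0 mule0 poweR_ge0.
pose rho := m `^ 3^-1.
have rho0 : 0 < rho by exact: powR_gt0.
have rho3 : rho ^+ 3 = m by rewrite -powR_mulrn ?ltW// -powRrM mulVf// powRr1// ltW.
have mN := measurable_sigma_p f0.
pose G x := (\int[mu3]_y ((sqdist x y)^-1 * normC2 (sigma_p f y))%:E)%E.
have kN0 x y : 0 <= (sqdist x y)^-1 * normC2 (sigma_p f y).
  by rewrite mulr_ge0 ?normC2_ge0// invr_ge0 sqdist_ge0.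
have G0 x : (0 <= G x)%E by apply: integral_ge0 => y _; rewrite lee_fin.
have mG : measurable_fun E (G : M3 -> \bar R).
  apply: measurable_funTS.
  have mF : measurable_fun setT
      ((fun p => ((sqdist p.1 p.2)^-1 * normC2 (sigma_p f p.2))%:E) : M3 * M3 -> \bar R).
    apply/measurable_EFinP; apply: measurable_funM.
      by apply: measurable_fun_inv_ge0; [move=> p; exact: sqdist_ge0|exact: measurable_sqdist].
    exact: (measurableT_comp (f := (fun y => normC2 (sigma_p f y)) : M3 -> R) mN measurable_snd).
  apply: (@measurable_fun_fubini_tonelli_F _ _ M3 M3 R (@mu3 R) _ mF) => p.
  by rewrite lee_fin.
have h1 : ((t * m)%:E <= (32 / 3)%:E * \int[mu3]_(x in E) G x)%E.
  rewrite EFinM -Em -(integral_cst (@mu3 R) mE) -ge0_integralZl//.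
  apply: ge0_le_integral => //.
  - by move=> x _; rewrite lee_fin ltW.
  - exact: emeasurable_funM.
  - move=> x Ex; apply: le_trans (spinor_le f0 x); rewrite lee_fin.
    exact: ltW.
have h2 : (\int[mu3]_(x in E) G x <= (65 * rho)%:E * I)%E.
  apply: integral_riesz_le => //; first by move=> y; exact: normC2_ge0.
  by rewrite rho3.
(* Since m = rho^3, the two bounds give t rho^3 <= (32/3) 65 rho I. One rho cancels, and 2080/3 <
   700 fixes the constant of the theorem. The power 3/2 of t rho^2 is t^(3/2) mu(E). *)
have key : ((t * rho ^+ 2)%:E <= 700%:E * I)%E.
  rewrite -(@lee_pmul2l _ rho%:E) ?lte_fin//.
  rewrite -EFinM (_ : rho * (t * rho ^+ 2) = t * m); last by rewrite -rho3; ring.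
  apply: (le_trans h1); apply: (le_trans (lee_wpmul2l _ h2)); first by rewrite lee_fin.
  rewrite !muleA -!EFinM lee_wpmul2r// lee_fin.
  by move: (ltW rho0); lra.
rewrite Em (_ : _ * _ = (t * rho ^+ 2)%:E `^ (3 / 2))%E; last first.
  rewrite poweR_EFin powRM ?sqr_ge0 ?(ltW t0)// -EFinM; congr (_ * _)%:E.
  rewrite -powR_mulrn ?(ltW rho0)// -powRrM (_ : 2%:R * (3 / 2) = 3%:R :> R); last by field.
  by rewrite powR_mulrn ?(ltW rho0).
apply: gt0_ler_poweR => //; rewrite in_itv/= leey andbT.
  by rewrite lee_fin mulr_ge0 ?sqr_ge0// ltW.
by apply: mule_ge0; [rewrite lee_fin; exact: ler0n|exact: I0].
Qed.
End WeakType.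

Theorem theorem2p1 (R : realType) :
  exists C1 : R, 0 < C1 /\
    forall f : R * R * R -> 'cV[R[i]]_2, C0infty f ->
      (weakL_norm (3 / 2) f <=
         C1%:E * \int[mu3]_x (normC2 (sigma_p f x))%:E)%E.
Proof.
exists 700; split; [exact: ltr0n|move=> f f0; rewrite /weakL_norm].
set J := (_ * integral _ _ _)%E.
have J0 : (0 <= J)%E.
  apply: mule_ge0; first by rewrite lee_fin; exact: ler0n.
  by apply: integral_ge0 => y _; rewrite lee_fin normC2_ge0.
(* Writing J as a power 1/q, with q = 3/2, lets monotonicity of that power reduce the claim to a
   bound on each member of the supremum. *)
have -> : J = ((J `^ (3 / 2)) `^ (3 / 2)^-1)%E.
  by rewrite -poweRrM mulfV ?poweRe1// lt0r_neq0// divr_gt0.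
apply: gt0_ler_poweR.
- by rewrite invr_ge0 divr_ge0.
- rewrite in_itv/= leey andbT.
  (* The supremum is nonnegative because its member at t = 1 is. *)
  apply: (@le_trans _ _ ((1 `^ (3 / 2))%:E * mu3 [set x | (1 < normC2 (f x))%R])%E).
    by apply: mule_ge0; [rewrite lee_fin powR_ge0|exact: (measure_ge0 (@mu3 R))].
  by apply: ereal_sup_ubound; exists 1 => //=; exact: ltr01.
- by rewrite in_itv/= leey poweR_ge0.
by apply: ge_ereal_sup => _ [t t0 <-]; exact: superlevel_le.
Qed.
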